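(* Let $R$ be the ring and $d_0\colon R^2\to R^2$ the map defined in the context. Set $M=\operatorname{Coker} d_0^*$, where $d_0^*=\operatorname{Hom}_R(d_0,R)$, and $N=R/(t,u,v-x,y-x,z-x)$. The following then hold: (1) $\widehat{\operatorname{Ext}}{}^i_R(M,N)=0$ for all $i>0$. (2) $\widehat{\operatorname{Ext}}{}^i_R(M,N)\neq 0$ for all $i<0$. (3) $\widehat{\operatorname{Tor}}{}_i^R(M,N)=0$ for all $i>0$. (4) $\widehat{\operatorname{Tor}}{}_i^R(M,N)\neq 0$ for all $i<0$.
   Context: Let $k$ be a field which is not algebraic over a finite field, and let $\alpha\in k$ be an element of infinite multiplicative order. Let $P=k[T,U,V,X,Y,Z]$ be the polynomial ring in six variables (each of degree one) and $R=P/I$, where $I$ is generated by the fifteen quadrics $$Z^2,\ UZ-TX-\alpha UV,\ U^2,\ YZ+VY,\ UY,\ Y^2-TX-(\alpha-1)UV,\ XZ+\alpha VX,\ UX,\ XY,\ X^2-TX-TV,$$ $$TZ+TY+\alpha VX,\ TU,\ TY-VX+TV,\ T^2+(\alpha+1)UV-VY,\ V^2.$$ Let $t,u,v,x,y,z$ denote the residue classes of the variables modulo $I$. The ring $R$ is a zero-dimensional Gorenstein local ring with maximal ideal $(t,u,v,x,y,z)$. The map $d_0\colon R^2\to R^2$ is given, acting on column vectors in the standard basis, by the matrix $\begin{pmatrix} v& y\\ \alpha x& z\end{pmatrix}$. A complete resolution of a finitely generated $R$-module $X$ is a complex $\boldsymbol T$ (indexed by $\mathbb Z$) of finitely generated free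 $R$-modules such that $\boldsymbol T$ and $\operatorname{Hom}_R(\boldsymbol T,R)$ are both exact and $\boldsymbol T_{\gg 0}=\boldsymbol F_{\gg 0}$ for some free resolution $\boldsymbol F$ of $X$. If $\boldsymbol T$ is a complete resolution of $X$ and $Y$ is an $R$-module, the Tate (co)homology groups are defined for all $i\in\mathbb Z$ by $$\widehat{\operatorname{Ext}}{}^i_R(X,Y)=\operatorname{H}_{-i}(\operatorname{Hom}_R(\boldsymbol T,Y)),\qquad \widehat{\operatorname{Tor}}{}_i^R(X,Y)=\operatorname{H}_i(\boldsymbol T\otimes_R Y).$$ *)

(* Defs.v *)
From HB Require Import structures.
From mathcomp Require Import all_boot all_order all_algebra.
From mathcomp Require Import generic_quotient ring_quotient.
From mathcomp Require Import boolp.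
From mathcomp Require Import finmap monalg.

Set Implicit Arguments.
Unset Strict Implicit.
Unset Printing Implicit Defensive.

Import GRing.Theory.
Local Open Scope ring_scope.
Local Open Scope quotient_scope.

Definition is_zero (M : zmodType) : Prop := forall x : M, x = 0.

Definition algebraic_over_finite_field (k : fieldType) : Prop :=
  exists (F : finFieldType) (iota : {rmorphism F -> k}),
    forall x : k, algebraicOver iota x.

Definition infinite_order (k : fieldType) (a : k) : Prop :=
  a != 0 /\ forall n : nat, (0 < n)%N -> a ^+ n != 1.

Section Modules.

Variable A : comNzRingType.

Section Quotient.

Variables (M : lmodType A) (P : M -> Prop).

Definition span : {pred M} := fun x : M =>
  `[< exists s : seq (A * M),
        (forall p, p \in s -> P p.2) /\ x = \sum_(p <- s) p.1 *: p.2 >].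

Lemma mem_span x : P x -> x \in span.
Proof.
move=> Px; apply/asboolP; exists [:: (1, x)]; split.
  by move=> p; rewrite inE => /eqP->.
by rewrite big_seq1 scale1r.
Qed.

Lemma span_submod : submod_closed span.
Proof.
split.
  by apply/asboolP; exists [::]; rewrite big_nil.
move=> a x y /asboolP[s [Ps ->]] /asboolP[r [Pr ->]]; apply/asboolP.
exists ([seq (a * p.1, p.2) | p <- s] ++ r); split.
  move=> p; rewrite mem_cat => /orP[/mapP[q qs ->]|]; last exact: Pr.
  exact: Ps q qs.
rewrite big_cat big_map /= scaler_sumr; congr (_ + _).
by apply: eq_bigr => p _; rewrite scalerA.
Qed.

Let span_zmod : zmod_closed span := span_submod.
HB.instance Definition _ := GRing.isZmodClosed.Build M span span_zmod.

Definition quotmod : Type := Quotient.quot span.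
HB.instance Definition _ := GRing.Zmodule.on quotmod.

Definition qproj (x : M) : quotmod := \pi_(Quotient.quot span) x.
Definition qrepr (x : quotmod) : M := repr (x : (Quotient.quot span)).

Lemma qreprK : cancel qrepr qproj.
Proof. exact: reprK. Qed.

Lemma qproj_eq x y : x - y \in span -> qproj x = qproj y.
Proof. by rewrite Quotient.idealrBE => /eqP. Qed.

Lemma qproj_inj x y : qproj x = qproj y -> x - y \in span.
Proof. by move=> e; rewrite Quotient.idealrBE; apply/eqP. Qed.

Lemma qprojD x y : qproj (x + y) = qproj x + qproj y.
Proof. exact: (raddfD (\pi_(Quotient.quot span))). Qed.

Lemma span_scale a x : x \in span -> a *: x \in span.
Proof.
by move=> xS; rewrite -[_ *: _]addr0; apply: span_submod.2 => //; case: span_submod.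
Qed.

Definition qscale (a : A) (x : quotmod) : quotmod := qproj (a *: qrepr x).

Lemma qscaleE a x : qscale a (qproj x) = qproj (a *: x).
Proof.
apply: qproj_eq; rewrite -scalerBr; apply: span_scale; apply: qproj_inj.
exact: qreprK.
Qed.

Fact qscaleA a b v : qscale a (qscale b v) = qscale (a * b) v.
Proof. by rewrite -[v]qreprK !qscaleE scalerA. Qed.

Fact qscale1 : left_id 1 qscale.
Proof. by move=> v; rewrite -[v]qreprK qscaleE scale1r. Qed.

Fact qscaleDr : right_distributive qscale +%R.
Proof.
by move=> a v w; rewrite -[v]qreprK -[w]qreprK -qprojD !qscaleE scalerDr qprojD.
Qed.

Fact qscaleDl v : {morph qscale^~ v : a b / a + b}.
Proof. by move=> a b; rewrite -[v]qreprK !qscaleE scalerDl qprojD. Qed.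

HB.instance Definition _ :=
  GRing.Zmodule_isLmodule.Build A quotmod qscaleA qscale1 qscaleDr qscaleDl.

Fact qproj_linear : linear qproj.
Proof. by move=> a x y; rewrite qprojD -qscaleE. Qed.

HB.instance Definition _ := GRing.isLinear.Build A M quotmod _ qproj qproj_linear.

Lemma qproj_eq0 x : P x -> qproj x = 0.
Proof.
by move=> Px; rewrite -(linear0 qproj); apply: qproj_eq; rewrite subr0 mem_span.
Qed.

Section Lift.

Variables (N : lmodType A) (f : {linear M -> N}).
Hypothesis fP : forall x, P x -> f x = 0.

Definition qlift of (forall x, P x -> f x = 0) :=
  fun x : quotmod => f (qrepr x).

Lemma qliftE x : qlift fP (qproj x) = f x.
Proof.
apply/eqP; rewrite -subr_eq0 -linearB /=; apply/eqP.
have /asboolP[s [Ps ->]] : qrepr (qproj x) - x \in span.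
  by apply: qproj_inj; rewrite qreprK.
rewrite linear_sum big_seq big1 // => p ps.
by rewrite linearZ /= fP ?scaler0 //; apply: Ps.
Qed.

Fact qlift_linear : linear (qlift fP).
Proof.
move=> a x y; rewrite -[x]qreprK -[y]qreprK -linearP !qliftE.
exact: linearP.
Qed.

HB.instance Definition _ :=
  GRing.isLinear.Build A quotmod N _ (qlift fP) qlift_linear.

End Lift.

End Quotient.

(* P need not be a submodule in quotmod P; in coker and homology it is one. *)
Definition coker (U V : lmodType A) (f : {linear U -> V}) : Type :=
  quotmod (fun y : V => exists x : U, y = f x).
HB.instance Definition _ U V f := GRing.Lmodule.on (@coker U V f).

Section Hom.

Variables U V : lmodType A.

Definition hom : Type := {linear U -> V}.

HB.instance Definition _ := gen_eqMixin hom.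
HB.instance Definition _ := gen_choiceMixin hom.

Definition hom_fun (f : hom) : {linear U -> V} := f.
Coercion hom_fun : hom >-> GRing.Linear.type.

Lemma homP (f g : hom) : hom_fun f =1 hom_fun g -> f = g.
Proof.
case: f g => [f [[f1] [f2]]] [g [[g1] [g2]]] /= /funext efg.
rewrite /hom_fun /= in efg; case: _ / efg in g1 g2 *.
by rewrite (Prop_irrelevance f1 g1) (Prop_irrelevance f2 g2).
Qed.

Definition hom0 : hom := (\0 : {linear U -> V}).
Definition homD (f g : hom) : hom :=
  (hom_fun f \+ hom_fun g : {linear U -> V}).
Definition homN (f : hom) : hom := (\- hom_fun f : {linear U -> V}).
Definition homZ (a : A) (f : hom) : hom := (a \*: hom_fun f : {linear U -> V}).

Fact homDA : associative homD.
Proof. by move=> f g h; apply: homP => x; apply: addrA. Qed.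
Fact homDC : commutative homD.
Proof. by move=> f g; apply: homP => x; apply: addrC. Qed.
Fact hom0D : left_id hom0 homD.
Proof. by move=> f; apply: homP => x; apply: add0r. Qed.
Fact homND : left_inverse hom0 homN homD.
Proof. by move=> f; apply: homP => x; apply: addNr. Qed.

HB.instance Definition _ := GRing.isZmodule.Build hom homDA homDC hom0D homND.

Fact homZA a b f : homZ a (homZ b f) = homZ (a * b) f.
Proof. by apply: homP => x; apply: scalerA. Qed.
Fact hom1Z : left_id 1 homZ.
Proof. by move=> f; apply: homP => x; apply: scale1r. Qed.
Fact homZDr : right_distributive homZ +%R.
Proof. by move=> a f g; apply: homP => x; apply: scalerDr. Qed.
Fact homZDl f : {morph homZ^~ f : a b / a + b}.
Proof. by move=> a b; apply: homP => x; apply: scalerDl. Qed.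

HB.instance Definition _ :=
  GRing.Zmodule_isLmodule.Build A hom homZA hom1Z homZDr homZDl.

End Hom.

Section HomPre.

Variables (U V W : lmodType A) (f : {linear U -> V}).

Definition hom_pre (g : hom V W) : hom U W :=
  (hom_fun g \o f : {linear U -> W}).

Fact hom_pre_linear : linear hom_pre.
Proof. by move=> a g h; apply: homP. Qed.

HB.instance Definition _ :=
  GRing.isLinear.Build A (hom V W) (hom U W) _ hom_pre hom_pre_linear.

End HomPre.

Section MalgLift.

Variables (K : choiceType) (N : lmodType A) (h : K -> N).

Definition malg_lift (g : {malg A[K]}) : N :=
  \sum_(k <- msupp g) g@_k *: h k.

Lemma malg_liftEw (g : {malg A[K]}) (D : {fset K}) :
  (msupp g `<=` D)%fset -> malg_lift g = \sum_(k <- D) g@_k *: h k.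
Proof.
move=> /fsubsetP gD; rewrite /malg_lift [RHS](bigID (mem (msupp g))) /=.
rewrite [X in _ = _ + X]big1 ?addr0; last first.
  by move=> k kg; rewrite mcoeff_outdom ?scale0r.
rewrite -[RHS]big_filter; apply: perm_big; apply: uniq_perm.
- exact: fset_uniq.
- exact: filter_uniq (fset_uniq _).
- by move=> k; rewrite mem_filter; case: (boolP (k \in msupp g)) => [/gD->|].
Qed.

Fact malg_lift_linear : linear malg_lift.
Proof.
move=> a g1 g2.
pose D := (msupp g1 `|` msupp g2 `|` msupp (a *: g1 + g2))%fset.
have D1 : (msupp g1 `<=` D)%fset by rewrite /D -fsetUA fsubsetUl.
have D2 : (msupp g2 `<=` D)%fset.
  by rewrite /D [(msupp g1 `|` _)%fset]fsetUC -fsetUA fsubsetUl.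
have D3 : (msupp (a *: g1 + g2) `<=` D)%fset by rewrite /D fsubsetUr.
rewrite (malg_liftEw D1) (malg_liftEw D2) (malg_liftEw D3).
rewrite scaler_sumr -big_split /=; apply: eq_bigr => k _.
by rewrite mcoeffD mcoeffZ scalerDl scalerA.
Qed.

HB.instance Definition _ :=
  GRing.isLinear.Build A {malg A[K]} N _ malg_lift malg_lift_linear.

Lemma malg_liftU k : malg_lift << k >> = h k.
Proof.
by rewrite (malg_liftEw (D := [fset k]%fset)) ?msuppU_le // big_seq_fset1
  mcoeffUU scale1r.
Qed.

End MalgLift.

Section Tensor.

Variables U V : lmodType A.

Inductive tensor_rel : {malg A[(U * V)%type]} -> Prop :=
| Tensor_addl u u' v :
    tensor_rel (<< (u + u', v) >> - << (u, v) >> - << (u', v) >>)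
| Tensor_addr u v v' :
    tensor_rel (<< (u, v + v') >> - << (u, v) >> - << (u, v') >>)
| Tensor_scalel a u v : tensor_rel (<< (a *: u, v) >> - a *: << (u, v) >>)
| Tensor_scaler a u v : tensor_rel (<< (u, a *: v) >> - a *: << (u, v) >>).

Definition tensor : Type := quotmod tensor_rel.
HB.instance Definition _ := GRing.Lmodule.on tensor.

Definition tens (u : U) (v : V) : tensor := qproj tensor_rel << (u, v) >>.

Lemma tensDl u u' v : tens (u + u') v = tens u v + tens u' v.
Proof.
apply/eqP; rewrite -subr_eq0 opprD addrA -!linearB; apply/eqP.
exact/qproj_eq0/Tensor_addl.
Qed.

Lemma tensDr u v v' : tens u (v + v') = tens u v + tens u v'.
Proof.
apply/eqP; rewrite -subr_eq0 opprD addrA -!linearB; apply/eqP.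
exact/qproj_eq0/Tensor_addr.
Qed.

Lemma tensZl a u v : tens (a *: u) v = a *: tens u v.
Proof.
apply/eqP; rewrite -subr_eq0 -linearZ -linearB; apply/eqP.
exact/qproj_eq0/Tensor_scalel.
Qed.

Lemma tensZr a u v : tens u (a *: v) = a *: tens u v.
Proof.
apply/eqP; rewrite -subr_eq0 -linearZ -linearB; apply/eqP.
exact/qproj_eq0/Tensor_scaler.
Qed.

End Tensor.

Section TensorMap.

Variables (U V W : lmodType A) (f : {linear U -> V}).

Definition tensor_pre : {linear {malg A[(U * W)%type]} -> tensor V W} :=
  malg_lift (fun p => tens (f p.1) p.2).

Fact tensor_preP g : tensor_rel g -> tensor_pre g = 0.
Proof.
case=> *; rewrite /tensor_pre ?linearB ?linearZ /= !malg_liftU /=.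
- by rewrite linearD tensDl addrAC addrK subrr.
- by rewrite tensDr addrAC addrK subrr.
- by rewrite linearZ tensZl scalerN subrr.
- by rewrite tensZr scalerN subrr.
Qed.

Definition tensor_map : {linear tensor U W -> tensor V W} := qlift tensor_preP.

Lemma tensor_mapE u w : tensor_map (tens u w) = tens (f u) w.
Proof. by rewrite /tensor_map /tens [LHS]qliftE /tensor_pre /= malg_liftU. Qed.

End TensorMap.

Lemma tensor_ind (U V W : lmodType A) (f g : {linear tensor U V -> W}) :
  (forall u v, f (tens u v) = g (tens u v)) -> f =1 g.
Proof.
move=> fg x; rewrite -[x]qreprK [qrepr x]monalgE !linear_sum.
apply: eq_bigr => -[u v] _.
have -> : << (qrepr x)@_(u, v) *g (u, v) >> = (qrepr x)@_(u, v) *: << (u, v) >>.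
  by apply/malgP => k; rewrite mcoeffZ !mcoeffU mulrnAr mulr1.
by rewrite !linearZ /=; congr (_ *: _); apply: fg.
Qed.

(* Chain complexes are homologically indexed by int.  The differential diff i j is
   given for all pairs of degrees, but vanishes unless i = j + 1; this avoids
   transports along equations between integers. *)
Record complex := Complex {
  obj :> int -> lmodType A;
  diff : forall i j : int, {linear obj i -> obj j};
  diff_shape : forall i j : int, i != j + 1 -> forall x, diff i j x = 0;
  diff_comp : forall (i j l : int) (x : obj i), diff j l (diff i j x) = 0
}.

Section Homology.

Variables (C : complex) (i : int).

Definition is_cycle : {pred C i} := fun x => diff C i (i - 1) x == 0.

Fact is_cycle_submod : submod_closed is_cycle.
Proof.
split; first by apply/eqP; rewrite linear0.
move=> a x y /eqP dx /eqP dy; apply/eqP.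
by rewrite linearP dx dy scaler0 addr0.
Qed.

HB.instance Definition _ := GRing.isSubmodClosed.Build A (C i) is_cycle is_cycle_submod.

Definition cycles : Type := {x : C i | x \in is_cycle}.
HB.instance Definition _ := SubType.on cycles.
HB.instance Definition _ := [Choice of cycles by <:].
HB.instance Definition _ := [SubChoice_isSubLmodule of cycles by <:].

Definition boundary (z : cycles) : Prop :=
  exists y : C (i + 1), val z = diff C (i + 1) i y.

Definition homology : Type := quotmod boundary.
HB.instance Definition _ := GRing.Lmodule.on homology.

Lemma homology_eq0 :
  is_zero homology <->
  (forall x : C i, diff C i (i - 1) x = 0 ->
     exists y : C (i + 1), x = diff C (i + 1) i y).
Proof.
split=> [H x dx|H q]; last first.
  rewrite -[q]qreprK; apply: qproj_eq0; rewrite /boundary.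
  by case: (qrepr q) => x xc; apply: H; apply/eqP.
have xc : x \in is_cycle by apply/eqP.
have := H (qproj boundary (exist _ x xc)).
rewrite -(linear0 (qproj boundary)) => /qproj_inj.
rewrite subr0 => /asboolP[s [Ps e]].
rewrite -[x]/(val (exist _ x xc : cycles)) e.
elim: s Ps {e} => [|p s IH] Ps; first by exists 0; rewrite big_nil !linear0.
have [|y ey] := IH; first by move=> q qs; apply: Ps; rewrite inE qs orbT.
have [z ez] := Ps p (mem_head _ _).
by exists (p.1 *: z + y); rewrite big_cons linearD linearZ /= ey linearP -ez.
Qed.

End Homology.

Definition acyclic (C : complex) : Prop := forall i : int, is_zero (homology C i).

(* Hom(C, Y), which in homological degree i is Hom(C_{-i}, Y).  The usual signs
   on its differential do not affect homology and are omitted. *)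
Section HomComplex.

Variables (C : complex) (Y : lmodType A).

Definition hom_obj (i : int) : lmodType A := hom (C (- i)) Y.
Definition hom_diff (i j : int) : {linear hom_obj i -> hom_obj j} :=
  hom_pre (diff C (- j) (- i)).

Fact hom_diff_shape i j : i != j + 1 -> forall x, hom_diff i j x = 0.
Proof.
move=> ij f; apply: homP => x /=; rewrite diff_shape ?linear0 //.
by apply: contra ij => /eqP e; rewrite -[i]opprK -[j]opprK e opprD addrNK.
Qed.

Fact hom_diff_comp i j l x : hom_diff j l (hom_diff i j x) = 0.
Proof. by apply: homP => c /=; rewrite diff_comp linear0. Qed.

Definition hom_complex : complex := Complex hom_diff_shape hom_diff_comp.

End HomComplex.

Section TensorComplex.

Variables (C : complex) (Y : lmodType A).

Definition tensor_obj (i : int) : lmodType A := tensor (C i) Y.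
Definition tensor_diff (i j : int) : {linear tensor_obj i -> tensor_obj j} :=
  tensor_map Y (diff C i j).

Fact tensor_diff_shape i j : i != j + 1 -> forall x, tensor_diff i j x = 0.
Proof.
move=> ij; apply: (tensor_ind (g := \0)) => u v.
rewrite /tensor_diff tensor_mapE diff_shape //.
by rewrite -(scale0r 0) tensZl scale0r.
Qed.

Fact tensor_diff_comp i j l x : tensor_diff j l (tensor_diff i j x) = 0.
Proof.
apply: (tensor_ind (f := tensor_diff j l \o tensor_diff i j) (g := \0)) => u v.
apply: etrans (congr1 (tensor_diff j l) (tensor_mapE _ _ _)) _.
apply: etrans (tensor_mapE _ _ _) _.
by rewrite diff_comp -(scale0r 0) tensZl scale0r.
Qed.

Definition tensor_complex : complex :=
  Complex tensor_diff_shape tensor_diff_comp.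

End TensorComplex.

Definition free_module (M : lmodType A) : Prop :=
  exists (I : choiceType) (f : {linear {malg A[I]} -> M}), bijective f.

Definition finite_free (M : lmodType A) : Prop :=
  exists (n : nat) (f : {linear 'rV[A]_n -> M}), bijective f.

Definition free_resolution (X : lmodType A) (F : complex) : Prop :=
  [/\ forall i : int, free_module (F i),
      forall i : int, i < 0 -> is_zero (F i),
      forall i : int, 0 < i -> is_zero (homology F i)
    & exists eps : {linear F 0 -> X},
        (forall x, exists y, x = eps y) /\
        (forall y, eps y = 0 <-> exists z, y = diff F 1 0 z)].

(* T_{>= n} and F_{>= n} are isomorphic complexes; phi is irrelevant below n. *)
Definition iso_from (n : int) (T F : complex) : Prop :=
  exists phi : forall i : int, {linear T i -> F i},
    (forall i, n <= i -> bijective (phi i)) /\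
    (forall i, n <= i -> forall x : T (i + 1),
       phi i (diff T (i + 1) i x) = diff F (i + 1) i (phi (i + 1) x)).

Definition complete_resolution (X : lmodType A) (T : complex) : Prop :=
  [/\ forall i : int, finite_free (T i),
      acyclic T,
      acyclic (hom_complex T A^o)
    & exists F : complex, free_resolution X F /\ exists n : int, iso_from n T F].

(* T is meant to be a complete resolution of the first argument of Ext or Tor. *)
Definition tate_ext (T : complex) (Y : lmodType A) (i : int) : lmodType A :=
  homology (hom_complex T Y) (- i).

Definition tate_tor (T : complex) (Y : lmodType A) (i : int) : lmodType A :=
  homology (tensor_complex T Y) i.

End Modules.

From mathcomp Require Import mpoly.

Section TheRing.

Variables (k : fieldType) (alpha : k).

Local Notation P := {mpoly k[6]}.
Local Notation T := ('X_(@Ordinal 6 0 isT) : P).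
Local Notation U := ('X_(@Ordinal 6 1 isT) : P).
Local Notation V := ('X_(@Ordinal 6 2 isT) : P).
Local Notation X := ('X_(@Ordinal 6 3 isT) : P).
Local Notation Y := ('X_(@Ordinal 6 4 isT) : P).
Local Notation Z := ('X_(@Ordinal 6 5 isT) : P).

Definition quadrics : 15.-tuple P := [tuple
  Z ^+ 2;
  U * Z - T * X - alpha *: (U * V);
  U ^+ 2;
  Y * Z + V * Y;
  U * Y;
  Y ^+ 2 - T * X - (alpha - 1) *: (U * V);
  X * Z + alpha *: (V * X);
  U * X;
  X * Y;
  X ^+ 2 - T * X - T * V;
  T * Z + T * Y + alpha *: (V * X);
  T * U;
  T * Y - V * X + T * V;
  T ^+ 2 + (alpha + 1) *: (U * V) - V * Y;
  V ^+ 2].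

Definition quadric_ideal : {pred P} := fun f : P =>
  `[< exists a : 'I_15 -> P, f = \sum_i a i * tnth quadrics i >].

Fact quadric_ideal_closed : idealr_closed quadric_ideal.
Proof.
split.
- apply/asboolP; exists (fun=> 0); rewrite big1 // => i _.
  by rewrite mul0r.
- apply/negP => /asboolP[a] /(congr1 (meval (fun=> 0))).
  rewrite meval1 raddf_sum big1 /= => [/eqP|i _]; first by rewrite oner_eq0.
  have : all (fun q => meval (fun=> 0) q == 0) quadrics.
    by rewrite /= !(mevalD, mevalB, mevalN, mevalZ, mevalXU, rmorphM, rmorphXn)
      /= !mevalXU !(expr0n, mulr0, mul0r, addr0, subr0, oppr0, eqxx).
  move=> /all_tnthP /(_ i) /eqP e.
  by rewrite mevalM e mulr0.
- move=> g f h /asboolP[a ->] /asboolP[b ->]; apply/asboolP.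
  exists (fun i => g * a i + b i); rewrite mulr_sumr -big_split /=.
  by apply: eq_bigr => i _; rewrite mulrDl mulrA.
Qed.

HB.instance Definition _ := isIdealr.Build P quadric_ideal quadric_ideal_closed.

Definition quadric_ring : comNzRingType := {ideal_quot quadric_ideal}.
Local Notation R := quadric_ring.

Definition residue (f : P) : R := \pi_({ideal_quot quadric_ideal}) f.

Local Notation t := (residue T).
Local Notation u := (residue U).
Local Notation v := (residue V).
Local Notation x := (residue X).
Local Notation y := (residue Y).
Local Notation z := (residue Z).

Definition d0_mx : 'M[R]_(1 + 1) :=
  block_mx v%:M                      y%:M
           (residue (alpha *: X))%:M z%:M.

Definition d0 : {linear 'cV[R]_2 -> 'cV[R]_2} := mulmx d0_mx.

Definition d0_dual : {linear hom 'cV[R]_2 R^o -> hom 'cV[R]_2 R^o} :=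
  hom_pre d0.

Definition M_mod : lmodType R := coker d0_dual.

Definition N_mod : lmodType R :=
  quotmod (fun w : R^o => w \in [:: t; u; v - x; y - x; z - x]).

End TheRing.

(* Main.v *)
(** Write D_c for the matrix (v y; c x z), so that d_0 = D_alpha.  One has
    D_(alpha c) D_c = 0, and ker D_(alpha c) = im D_c unless c = 1 or
    alpha c = 1.  As alpha has infinite order, the D_(alpha^n), n >= 1, form an
    exact half-infinite complex of modules R^2.  At its end exactness fails:
    ker d_0 is generated by the columns of D_1 together with (0, tv).  From
    there on the minimal resolution of ker d_0 has strictly increasing ranks:
    R has Hilbert function 1, 6, 6, 1, hence a minimal cover of a kernel of
    length at least 9p in R^p needs at least 2p generators, and the length of
    its own kernel again satisfies such a bound.  Splicing and transposing,
    which preserves exactness because R is Gorenstein, gives a complete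
    resolution of M.  Now N is the ring of dual numbers k[x]/(x^2), over which
    D_c becomes (1 1; c 1) x with determinant factor 1 - c: the homology
    vanishes on the side of the D_(alpha^n), whereas on the other side matrices
    with entries in the maximal ideal and strictly varying ranks leave homology
    in every degree.  Any two complete resolutions of M are homotopy equivalent
    in every finite range of degrees, so the choice does not matter. *)

From HB Require Import structures.
Require Import Defs.
From mathcomp Require Import all_boot all_order all_algebra.
From mathcomp Require Import generic_quotient ring_quotient boolp finmap monalg.
From mathcomp Require Import ring zify.

Set Implicit Arguments.
Unset Strict Implicit.
Unset Printing Implicit Defensive.

Import Order.TTheory GRing.Theory Num.Theory.
Local Open Scope ring_scope.

(** * Linear algebra and complexes *)

(** Everything about [R] rests on one linear form. A functional on cubics that kills the ideal
    descends to [socle_form], and the bilinear form [socle_form (r * s)] has the explicit dual bases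
    [basis] and [dual_basis]. This shows that the fourteen spanning monomials are independent, and
    it turns every [k]-linear functional on R^p into a pairing with a vector; that is the
    self-injectivity behind transposing exact sequences. Over N, a matrix B with entries in the
    maximal ideal sends a + a'x to x theta(B)a. Hence, for such B and C, exactness of N^p -> N^q ->
    N^r (C, then B) means that theta(B) is injective and theta(C) surjective. A strict change of
    rank destroys one of the two: injectivity in the Hom complex, surjectivity in the tensor
    complex. So one inequality of ranks serves both Ext and Tor. A complete resolution has no lowest
    degree at which an induction could start. Two of them are therefore compared in high degrees,
    where they agree with free resolutions, and the maps are pushed downwards using exactness of Hom
    into finite free modules. *)

Lemma dim_le_inj (K : fieldType) (U V : vectType K) (f : 'Hom(U, V)) (S : {vspace U}) :
  (forall w, w \in S -> f w = 0 -> w = 0) -> (\dim S <= dim V)%N.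
Proof.
move=> inj; rewrite -(limg_ker_dim f S) (_ : (S :&: lker f)%VS = 0%VS).
  by rewrite dimv0 add0n -(dimvf V) dimvS ?subvf.
apply/eqP; rewrite -subv0; apply/subvP => w; rewrite memv_cap memv_ker.
by case/andP=> wS /eqP/(inj w wS) ->; rewrite mem0v.
Qed.

Section Entries.
Variables (K : fieldType) (m n : nat) (s : seq ('I_m * 'I_n)).

(** With [dim_le_inj] this bounds the dimension of a space of matrices in which the entries listed
    in [s] determine all others. *)
Definition entries (M : 'M[K]_(m, n)) : 'rV[K]_(size s) :=
  \row_i M (tnth (in_tuple s) i).1 (tnth (in_tuple s) i).2.

Fact entries_linear : linear entries.
Proof. by move=> c M N; apply/rowP => i; rewrite !mxE. Qed.
HB.instance Definition _ :=
  GRing.isLinear.Build K 'M[K]_(m, n) 'rV[K]_(size s) _ entries entries_linear.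

Lemma entries_eq0 M : entries M = 0 -> forall p, p \in s -> M p.1 p.2 = 0.
Proof.
move=> M0 p /(nthP p)[i lt_i <-]; have /rowP/(_ (Ordinal lt_i)) := M0.
by rewrite !mxE !(tnth_nth p).
Qed.

End Entries.

Lemma span_image (A : comNzRingType) (U V : lmodType A) (f : {linear U -> V}) w :
  w \in Defs.span (fun y => exists x, y = f x) -> exists x, w = f x.
Proof.
move=> /asboolP[s [Ps ->]]; elim: s Ps => [|p s IH] Ps.
  by exists 0; rewrite big_nil linear0.
have [|x0 e] := IH; first by move=> q qs; apply: Ps; rewrite inE qs orbT.
have [x1 e1] := Ps p (mem_head _ _).
by exists (p.1 *: x1 + x0); rewrite big_cons e e1 linearP.
Qed.

Definition exact_mx (A : comNzRingType) p q r (B : 'M[A]_(r, q)) (C : 'M[A]_(q, p)) :=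
  B *m C = 0 /\ forall w : 'cV_q, B *m w = 0 -> exists w', w = C *m w'.

(** * Self-duality of free modules over a Frobenius algebra *)

Section Frobenius.

Variables (k : fieldType) (R : comNzRingType) (iota : {rmorphism k -> R}).
Variables (lam : R -> k) (n : nat) (e e' : 'I_n -> R).
Hypothesis lamD : {morph lam : r s / r + s}.
Hypothesis lamZ : forall c r, lam (iota c * r) = c * lam r.
Hypothesis lam_dual : forall i j, lam (e' i * e j) = (i == j)%:R.
Hypothesis lam_span : forall r, r = \sum_i iota (lam (e' i * r)) * e i.

(** No [k]-vector space structure is attached to [R], so kernels and images get their [k]-dimension
    through coordinate matrices. The coordinate along [e j] is read off by the dual element
    [e' j]. *)
Definition encode p (v : 'cV[R]_p) : 'M[k]_(p, n) :=
  \matrix_(i, j) lam (e' j * v i 0).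
Definition decode p (M : 'M[k]_(p, n)) : 'cV[R]_p :=
  \col_i \sum_j iota (M i j) * e j.

Lemma encodeK p : cancel (@encode p) (@decode p).
Proof.
move=> v; apply/colP => i; rewrite mxE [RHS]lam_span.
by apply: eq_bigr => j _; rewrite mxE.
Qed.

Lemma lam0 : lam 0 = 0.
Proof. by rewrite -[X in lam X](mulr0 (iota 0)) lamZ mul0r. Qed.

Lemma lam_sum I (r : seq I) (F : I -> R) :
  lam (\sum_(i <- r) F i) = \sum_(i <- r) lam (F i).
Proof. exact: (big_morph lam lamD lam0). Qed.

Lemma decodeK p : cancel (@decode p) (@encode p).
Proof.
move=> M; apply/matrixP => i j; rewrite !mxE mulr_sumr lam_sum (bigD1 j) //=.
rewrite mulrCA lamZ lam_dual eqxx mulr1 big1 ?addr0 // => l /negPf lj.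
by rewrite mulrCA lamZ lam_dual eq_sym lj mulr0.
Qed.

Lemma decode_is_additive p (M N : 'M_(p, n)) : decode (M + N) = decode M + decode N.
Proof.
apply/colP => i; rewrite !mxE -big_split; apply: eq_bigr => j _.
by rewrite mxE rmorphD mulrDl.
Qed.

Lemma decodeZ p c (M : 'M_(p, n)) : decode (c *: M) = iota c *: decode M.
Proof.
apply/colP => i; rewrite !mxE mulr_sumr; apply: eq_bigr => j _.
by rewrite mxE rmorphM mulrA.
Qed.

Lemma encode_is_additive p (v w : 'cV_p) : encode (v + w) = encode v + encode w.
Proof. by apply: (can_inj (@decodeK p)); rewrite decode_is_additive !encodeK. Qed.

Lemma encodeZ p c (v : 'cV_p) : encode (iota c *: v) = c *: encode v.
Proof. by apply: (can_inj (@decodeK p)); rewrite decodeZ !encodeK. Qed.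

Lemma decode0 p : decode (0 : 'M_(p, n)) = 0.
Proof. by rewrite -(scale0r 0) decodeZ rmorph0 scale0r. Qed.

Lemma encode0 p : encode (0 : 'cV_p) = 0.
Proof. by rewrite -[X in encode X]decode0 decodeK. Qed.

Definition restrict_scalars p q (A : 'M[R]_(q, p)) (M : 'M[k]_(p, n)) :=
  encode (A *m decode M).

Fact restrict_scalars_linear p q (A : 'M[R]_(q, p)) : linear (restrict_scalars A).
Proof.
move=> c M N; rewrite /restrict_scalars decode_is_additive decodeZ mulmxDr.
by rewrite -scalemxAr encode_is_additive encodeZ.
Qed.
HB.instance Definition _ (p q : nat) (A : 'M[R]_(q, p)) :=
  GRing.isLinear.Build k 'M[k]_(p, n) 'M[k]_(q, n) _
  (@restrict_scalars p q A) (@restrict_scalars_linear p q A).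

Definition mxhom p q (A : 'M[R]_(q, p)) : 'Hom('M[k]_(p, n), 'M[k]_(q, n)) :=
  linfun (restrict_scalars A).

Lemma mxhomE p q (A : 'M[R]_(q, p)) v : mxhom A (encode v) = encode (A *m v).
Proof. by rewrite lfunE /= /restrict_scalars encodeK. Qed.

Lemma mxhom_rank_nullity p q (A : 'M[R]_(q, p)) :
  (\dim (lker (mxhom A)) + \dim (limg (mxhom A)) = p * n)%N.
Proof.
by rewrite -[RHS](dim_matrix k) -dimvf -(limg_ker_dim (mxhom A) fullv) capfv.
Qed.

Lemma mem_lker_mxhom p q (A : 'M[R]_(q, p)) v :
  (encode v \in lker (mxhom A)) = (A *m v == 0).
Proof.
by rewrite memv_ker mxhomE -(encode0 q) (can_eq (@encodeK q)).
Qed.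

Definition pairing p (v w : 'cV[R]_p) : k := lam ((v^T *m w) 0 0).

(* Every k-linear form on R^p is the pairing with a vector, which makes R self-injective. *)
Lemma pairing_rep p (f : 'Hom('M[k]_(p, n), k^o)) :
  exists w : 'cV[R]_p, forall v, f (encode v) = pairing v w.
Proof.
exists (\col_i \sum_j iota (f (delta_mx i j)) * e' j) => v.
rewrite {1}[encode v]matrix_sum_delta linear_sum /pairing mxE lam_sum.
apply: eq_bigr => i _; rewrite linear_sum !mxE mulr_sumr lam_sum.
apply: eq_bigr => j _; rewrite linearZ /= mxE mulrCA lamZ [X in lam X]mulrC.
exact: mulrC.
Qed.

Lemma pairing_eq0 p (w : 'cV[R]_p) : (forall v, pairing v w = 0) -> w = 0.
Proof.
move=> w0; apply/colP => i; rewrite [RHS]mxE [LHS]lam_span big1 // => j _.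
suff -> : lam (e' j * w i 0) = 0 by rewrite rmorph0 mul0r.
rewrite -(w0 (e' j *: delta_mx i 0)) /pairing linearZ /= -scalemxAl mxE.
by rewrite trmx_delta -rowE mxE.
Qed.

Lemma pairing_mulmx p q (A : 'M[R]_(q, p)) v w :
  pairing (A *m v) w = pairing v (A^T *m w).
Proof. by rewrite /pairing trmx_mul mulmxA. Qed.

(** The functional pairing with [y] vanishes on the image of [B], hence on the kernel of [A]. It
    therefore factors through [A], and the factor, extended to R^r, is the pairing with some [z];
    nondegeneracy then gives [y = A^T *m z]. *)
Lemma dual_exact p q r (A : 'M[R]_(r, q)) (B : 'M[R]_(q, p)) :
  (forall v : 'cV_q, A *m v = 0 -> exists w, v = B *m w) ->
  forall y : 'cV_q, B^T *m y = 0 -> exists z, y = A^T *m z.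
Proof.
move=> exAB y By0.
have phi_lin : linear (fun M : 'M[k]_(q, n) => pairing (decode M) y : k^o).
  move=> c M N; rewrite /pairing decode_is_additive decodeZ linearP /= mulmxDl mxE.
  by rewrite -scalemxAl mxE lamD lamZ.
pose phiL := GRing.isLinear.Build k 'M[k]_(q, n) k^o *:%R _ phi_lin.
pose phi : {linear 'M[k]_(q, n) -> k^o} :=
  HB.pack (fun M : 'M[k]_(q, n) => pairing (decode M) y : k^o) phiL.
(* The linear map [(mxhom A)^-1] is a section of [mxhom A] over its image and is defined everywhere,
   so it factors the functional and extends the factor at once. *)
have [z zP] := pairing_rep (linfun phi \o (mxhom A)^-1)%VF.
exists z; apply/eqP; rewrite -subr_eq0; apply/eqP/pairing_eq0 => v.
have phiE w : phi (encode w) = pairing w y by rewrite /= encodeK.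
have phi0 M : M \in lker (mxhom A) -> phi M = 0.
  rewrite -[M]decodeK mem_lker_mxhom => /eqP/exAB[w ->].
  by rewrite phiE pairing_mulmx By0 /pairing mulmx0 mxE lam0.
have -> : pairing v (y - A^T *m z) = pairing v y - pairing (A *m v) z.
  rewrite pairing_mulmx /pairing mulmxBr; apply: (addIr (lam ((v^T *m (A^T *m z)) 0 0))).
  by rewrite subrK -lamD; congr lam; rewrite [X in X + _]mxE [X in _ + X + _]mxE subrK.
rewrite -phiE -zP -mxhomE comp_lfunE [linfun _ _]lfunE -linearB; apply: phi0.
by rewrite memv_ker linearB /= limg_lfunVK ?memv_img ?memvf // subrr.
Qed.

End Frobenius.

(** * Exactness, free modules and retracts of complexes *)

Section Linear.

Variable A : comNzRingType.

Lemma linear_of (U V : lmodType A) (f : U -> V) :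
  linear f -> exists g : {linear U -> V}, g =1 f.
Proof.
move=> lin_f; pose fL := GRing.isLinear.Build A U V *:%R f lin_f.
by exists (HB.pack_for {linear U -> V} f fL).
Qed.

Lemma linear_inverse (U V : lmodType A) (f : {linear U -> V}) : bijective f ->
  exists g : {linear V -> U}, cancel f g /\ cancel g f.
Proof.
move=> [g fK gK]; have lin_g : linear g.
  by move=> a x y; apply: (can_inj fK); rewrite linearP !gK.
by have [g' g'E] := linear_of lin_g; exists g'; split=> x; rewrite g'E.
Qed.

Lemma malg_ext (I : choiceType) (V : lmodType A) (f g : {linear {malg A[I]} -> V}) :
  (forall i, f << i >> = g << i >>) -> f =1 g.
Proof.
move=> fg x; rewrite [x]monalgE !linear_sum; apply: eq_bigr => i _.
have -> : << x@_i *g i >> = x@_i *: << i >> :> {malg A[I]}.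
  by apply/malgP => j; rewrite mcoeffZ !mcoeffU mulrnAr mulr1.
by rewrite !linearZ /= fg.
Qed.

Lemma free_lift (P U V : lmodType A) (d : {linear U -> V}) (f : {linear P -> V}) :
  free_module P -> (forall x, exists y, f x = d y) ->
  exists g : {linear P -> U}, forall x, f x = d (g x).
Proof.
move=> [I [e /linear_inverse[e' [eK e'K]]]] fd.
have [c cP] := choice (fun i => fd (e << i >>)).
pose g : {linear {malg A[I]} -> U} := malg_lift c.
exists (g \o e' : {linear P -> U}) => x.
rewrite -[x]e'K /= eK; move: (e' x) => {}x.
apply: (malg_ext (f := f \o e) (g := d \o g)) => i /=.
by rewrite malg_liftU cP.
Qed.

Lemma hom_linE (U V : lmodType A) (a : A) (f g : Defs.hom U V) c :
  (a *: f + g) c = a *: f c + g c.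
Proof. by []. Qed.

Definition exact_at (C : complex A) (i j l : int) : Prop :=
  forall x : C j, diff C j l x = 0 -> exists y : C i, x = diff C i j y.

(** Exactness of Hom(C, Y) at Hom(C j, Y), stated in the degrees of [C]; the negated degrees of
    [hom_complex] then occur only in the translation lemmas. *)
Definition hom_exact (C : complex A) (Y : lmodType A) (i j l : int) : Prop :=
  forall xi : {linear C j -> Y}, (forall x, xi (diff C i j x) = 0) ->
  exists eta : {linear C l -> Y}, forall x, xi x = eta (diff C j l x).

Lemma homology_exact (C : complex A) (i j l : int) : i = j + 1 -> j = l + 1 ->
  is_zero (homology C j) <-> exact_at C i j l.
Proof.
move=> -> jl; have -> : l = j - 1 by rewrite jl addrK.
exact: homology_eq0.
Qed.

Lemma exact_at_hom (C : complex A) (Y : lmodType A) (i j l : int) :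
  exact_at (hom_complex C Y) i j l <-> hom_exact C Y (- l) (- j) (- i).
Proof.
split=> ex xi xi0.
  have [|eta eE] := ex (xi : Defs.hom (C (- j)) Y).
    by apply: homP => x /=; apply: xi0.
  exists (hom_fun eta) => x.
  exact: (congr1 (fun f : Defs.hom (C (- j)) Y => hom_fun f x) eE).
have [|eta eE] := ex (hom_fun xi).
  by move=> x; apply: (congr1 (fun f : Defs.hom (C (- l)) Y => hom_fun f x) xi0).
by exists (eta : Defs.hom (C (- i)) Y); apply: homP => x /=; apply: eE.
Qed.

Lemma tate_ext_exact (C : complex A) (Y : lmodType A) (i j l : int) :
  i = j + 1 -> j = l + 1 -> is_zero (tate_ext C Y j) <-> hom_exact C Y i j l.
Proof.
move=> ij jl; rewrite /tate_ext (@homology_exact _ (- l) _ (- i)).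
- by rewrite exact_at_hom !opprK.
- by rewrite jl opprD subrK.
- by rewrite ij opprD subrK.
Qed.

Lemma tate_tor_exact (C : complex A) (Y : lmodType A) (i j l : int) :
  i = j + 1 -> j = l + 1 -> is_zero (tate_tor C Y j) <->
  exact_at (tensor_complex C Y) i j l.
Proof. exact: homology_exact. Qed.

(** Coordinates on [W] split the problem into maps to the ring. Thus acyclicity of the dual complex,
    which is all that a complete resolution provides, allows extension of maps into any finite free
    module. *)
Lemma hom_exact_free (C : complex A) (W : lmodType A) (i j l : int) :
  hom_exact C A^o i j l -> finite_free W -> hom_exact C W i j l.
Proof.
move=> ex [n [e /linear_inverse[e' [eK e'K]]]] xi xi0.
have coordE (c : 'I_n) : exists eta : {linear C l -> A^o},
    forall x, e' (xi x) 0 c = eta (diff C j l x).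
  have lin_c : linear (fun x => e' (xi x) 0 c : A^o).
    by move=> a x y; rewrite !linearP /= !mxE.
  have [xic xicE] := linear_of lin_c.
  have [x|eta etaE] := ex xic; first by rewrite xicE xi0 linear0 mxE.
  by exists eta => x; rewrite -etaE xicE.
have [eta etaE] := choice coordE.
have lin_row : linear (fun x => \row_c eta c x : 'rV[A]_n).
  by move=> a x y; apply/rowP => c; rewrite !mxE linearP.
have [r rE] := linear_of lin_row.
exists (e \o r : {linear C l -> W}) => x /=.
rewrite -[LHS]e'K; congr (e _); apply/rowP => c.
by rewrite rE mxE etaE.
Qed.

(** Changes a dependent family at one index. The cast is harmless because equality proofs in an
    [eqType] are unique. *)
Definition update (I : eqType) (E : I -> Type) (f : forall i, E i) (j : I) (e : E j) i : E i :=
  if j =P i is ReflectT ji then ecast i (E i) ji e else f i.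

Lemma update_same (I : eqType) (E : I -> Type) (f : forall i, E i) j (e : E j) :
  update f e j = e.
Proof. by rewrite /update; case: eqP => // ji; rewrite (eq_axiomK ji). Qed.

Lemma update_other (I : eqType) (E : I -> Type) (f : forall i, E i) j (e : E j) i :
  j != i -> update f e i = f i.
Proof. by rewrite /update; case: eqP. Qed.

Definition family (C D : complex A) := forall i : int, {linear C i -> D i}.

(* Indexing by arbitrary pairs of degrees, although only (j, j + 1) is used,
   avoids transports along equalities of integers. *)
Definition homotopy (C : complex A) := forall p : int * int, {linear C p.1 -> C p.2}.

Definition commutes_at (C D : complex A) (f : family C D) (i j : int) :=
  forall x, f j (diff C i j x) = diff D i j (f i x).

Definition homotopy_at (C : complex A) (f : family C C) (h : homotopy C) (i j l : int) :=
  forall x, f j x = diff C i j (h (j, i) x) + h (l, j) (diff C j l x).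

(** Half of a homotopy equivalence, restricted to the two squares and the one homotopy identity that
    a diagram chase at degree [j] uses. This half carries exactness from [D] to [C]. *)
Definition retract (C D : complex A) (i j l : int) :=
  exists (f : family C D) (g : family D C) (h : homotopy C),
  [/\ commutes_at f j l, commutes_at g i j &
      homotopy_at (fun m => (g m \o f m) \- idfun) h i j l].

(** A cocycle [xi] on [C] pulls back along [g] to a cocycle on [D], say eta d. Since [xi] kills d h,
    the map eta f - xi h then bounds [xi]. *)
Lemma retract_hom (C D : complex A) (Y : lmodType A) (i j l : int) :
  retract C D i j l -> hom_exact D Y i j l -> hom_exact C Y i j l.
Proof.
move=> [f [g [h [fc gc hc]]]] ex xi xi0.
have [x|eta etaE] := ex (xi \o g j : {linear D j -> Y}).
  by rewrite /= gc xi0.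
exists ((eta \o f l) \- (xi \o h (l, j)) : {linear C l -> Y}) => x /=.
have E : g j (f j x) = x + (diff C i j (h (j, i) x) + h (l, j) (diff C j l x)).
  by rewrite -hc /= addrC subrK.
by rewrite fc -etaE /= E !linearD /= xi0 add0r addrK.
Qed.

Lemma tensor_map_comp (U V W Y : lmodType A) (f : {linear U -> V}) (g : {linear V -> W}) x :
  tensor_map Y g (tensor_map Y f x) = tensor_map Y (g \o f) x.
Proof.
apply: (tensor_ind (f := tensor_map Y g \o tensor_map Y f)) => u w.
apply: etrans (congr1 (tensor_map Y g) (tensor_mapE f u w)) _.
by rewrite !tensor_mapE.
Qed.

Lemma eq_tensor_map (U V Y : lmodType A) (f g : {linear U -> V}) x :
  f =1 g -> tensor_map Y f x = tensor_map Y g x.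
Proof. by move=> fg; apply: tensor_ind x => u w; rewrite !tensor_mapE fg. Qed.

Lemma tensor_mapD (U V Y : lmodType A) (f g : {linear U -> V}) x :
  tensor_map Y (f \+ g) x = tensor_map Y f x + tensor_map Y g x.
Proof.
apply: (tensor_ind (g := tensor_map Y f \+ tensor_map Y g)) => u w.
rewrite tensor_mapE tensDl; symmetry.
by congr (_ + _); rewrite tensor_mapE.
Qed.

Lemma tensor_map_id (U Y : lmodType A) x : tensor_map Y (idfun : {linear U -> U}) x = x.
Proof.
apply: (tensor_ind (f := tensor_map Y idfun) (g := idfun)) => u w.
exact: tensor_mapE.
Qed.

(** For a cycle x one has g(f x) = x + d(h x) after tensoring, and f x is a boundary; so x is the
    boundary of g y - h x. *)
Lemma retract_tensor (C D : complex A) (Y : lmodType A) (i j l : int) :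
  retract C D i j l -> exact_at (tensor_complex D Y) i j l ->
  exact_at (tensor_complex C Y) i j l.
Proof.
move=> [f [g [h [fc gc hc]]]] ex x dx0.
have {}dx0 : tensor_map Y (diff C j l) x = 0 by exact: dx0.
have [|y yE] := ex (tensor_map Y (f j) x).
  apply: etrans (tensor_map_comp _ _ _) _.
  rewrite -(eq_tensor_map (f := f l \o diff C j l)); last by move=> w /=; rewrite fc.
  by rewrite -tensor_map_comp dx0 linear0.
have {}yE : tensor_map Y (f j) x = tensor_map Y (diff D i j) y by exact: yE.
exists (tensor_map Y (g i) y - tensor_map Y (h (j, i)) x).
suff: x = tensor_map Y (diff C i j) (tensor_map Y (g i) y - tensor_map Y (h (j, i)) x).
  by [].
have E : tensor_map Y (g j) (tensor_map Y (f j) x) =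
    x + (tensor_map Y (diff C i j) (tensor_map Y (h (j, i)) x) +
     tensor_map Y (h (l, j)) (tensor_map Y (diff C j l) x)).
  rewrite !tensor_map_comp -tensor_mapD -[X in X + _]tensor_map_id -tensor_mapD.
  by apply: eq_tensor_map => w /=; rewrite -hc /= addrC subrK.
move: E; rewrite dx0 [tensor_map Y (h (l, j)) 0]linear0 addr0 => E.
rewrite [RHS](linearB (tensor_map Y (diff C i j))).
apply/eqP; rewrite eq_sym subr_eq -E yE !tensor_map_comp; apply/eqP.
by apply: eq_tensor_map => w /=; rewrite gc.
Qed.

End Linear.

(** * Uniqueness of complete resolutions up to homotopy *)

Section Comparison.

Variable A : comNzRingType.
Implicit Types C D F : complex A.

(* Since Hom(C, -) is exact on finite free modules, a chain map extends one degree down. *)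
Lemma chain_down C D (f : family C D) (lo hi : int) :
  (forall i j l, i = j + 1 -> j = l + 1 -> hom_exact C (D l) i j l) ->
  lo < hi ->
  (forall i j, i = j + 1 -> lo <= j -> j < hi -> commutes_at f i j) ->
  forall m : nat, exists f' : family C D,
    (forall i, lo <= i -> f' i = f i) /\
    (forall i j, i = j + 1 -> lo - m%:Z <= j -> j < hi -> commutes_at f' i j).
Proof.
move=> exC lohi fc; elim=> [|m [f' [f'E f'c]]].
  by exists f; split=> // i j ij; rewrite subr0; apply: fc.
have [l lE] : exists l, l = lo - m.+1%:Z by eexists.
have [j jE] : exists j, j = lo - m%:Z by eexists.
have [i ij] : exists i, i = j + 1 by eexists.
have jl : j = l + 1 by lia.
have [x|e eE] := exC i j l ij jl (diff D j l \o f' j).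
  by rewrite /= f'c ?diff_comp //; lia.
exists (update f' e); split=> [n lo_n|n p np lo_p p_hi x].
  by rewrite update_other ?f'E //; apply/eqP; lia.
have [lp|lp] := eqVneq l p.
  have nj : n = j by lia.
  clear np; subst p n; rewrite update_same update_other; last by apply/eqP; lia.
  by rewrite -eE.
by rewrite !update_other ?f'c //; [move/eqP: lp; lia|apply/eqP; lia].
Qed.

(** With the homotopy identity known one degree higher, f d = d f = d h d, so [f j] minus d h kills
    boundaries and factors through the next differential. The factor is the new component of the
    homotopy. The condition [lo + 1 < hi] makes that higher identity available already at the first
    step. *)
Lemma homotopy_down C (f : family C C) (h : homotopy C) (lo hi : int) (m : nat) :
  (forall i j l, i = j + 1 -> j = l + 1 -> hom_exact C (C j) i j l) ->
  lo + 1 < hi ->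
  (forall i j, i = j + 1 -> lo - m%:Z <= j -> j < hi -> commutes_at f i j) ->
  (forall i j l, i = j + 1 -> j = l + 1 -> lo <= l -> j < hi -> homotopy_at f h i j l) ->
  exists h' : homotopy C,
    forall i j l, i = j + 1 -> j = l + 1 -> lo - m%:Z <= l -> j < hi ->
      homotopy_at f h' i j l.
Proof.
move=> exC lohi; elim: m => [|m IH] fc hc.
  by exists h => i j l ij jl; rewrite subr0; apply: hc.
have [i j ij lo_j j_hi|//|h' h'c] := IH; first by apply: fc => //; lia.
have [l lE] : exists l, l = lo - m.+1%:Z by eexists.
have [j jE] : exists j, j = lo - m%:Z by eexists.
have [i ij] : exists i, i = j + 1 by eexists.
have [n ni] : exists n, n = i + 1 by eexists.
have jl : j = l + 1 by lia.
have [x|e eE] := exC i j l ij jl (f j \- (diff C i j \o h' (j, i))).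
  rewrite /= fc //; try lia. rewrite (h'c n i j) //; try lia.
  by rewrite linearD diff_comp add0r subrr.
exists (@update _ _ h' (l, j) e) => i' j' l' ij' jl' lo_l j_hi x.
have [ll'|ll'] := eqVneq l l'.
  have jj' : j' = j by lia.
  have ii' : i' = i by lia.
  clear ij' jl'; subst l' j' i'; rewrite update_same update_other;
    last by rewrite xpair_eqE; apply/nandP; left; apply/eqP; lia.
  by rewrite -eE /= addrC subrK.
have U1 : (l, j) != (j', i').
  by rewrite xpair_eqE; apply/nandP; left; apply/eqP; lia.
have U2 : (l, j) != (l', j') by rewrite xpair_eqE (negPf ll').
by rewrite !update_other //; apply: h'c => //; move/eqP: ll'; lia.
Qed.

Definition augmentation (X : lmodType A) C (eps : {linear C 0 -> X}) :=
  (forall x, exists y, x = eps y) /\ (forall y, eps y = 0 <-> exists z, y = diff C 1 0 z).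

(** The usual lifting argument, stopped at degree [m]: homology in one degree sees only three
    modules, so finitely many components suffice and each step alters the family in one place. *)
Lemma resolution_chain_map (X : lmodType A) C D (eps : {linear C 0 -> X})
    (eps' : {linear D 0 -> X}) :
  (forall i, free_module (C i)) -> augmentation eps -> augmentation eps' ->
  (forall i j l : int, i = j + 1 -> j = l + 1 -> 0 < j -> exact_at D i j l) ->
  forall m : nat, exists f : family C D, (forall x, eps' (f 0 x) = eps x) /\
    forall i j, i = j + 1 -> 0 <= j -> j < m%:Z -> commutes_at f i j.
Proof.
move=> freeC [_ augC] [epi' augD] exD; elim=> [|m [f [f0 fc]]].
  have [x|f0 f0E] := free_lift (d := eps') (f := eps) (freeC 0).
    exact: epi'.
  exists (update (fun i => (\0 : {linear C i -> D i})) f0); split; last by move=> i j _; lia.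
  by move=> x; rewrite update_same -f0E.
have [j jE] : exists j, j = m%:Z by eexists.
have [i ij] : exists i, i = j + 1 by eexists.
have [x|e eE] := free_lift (d := diff D i j) (f := f j \o diff C i j) (freeC i).
  rewrite /=; case: m fc jE => [|m] fc jE.
    subst i j; have /augD[z zE] : eps' (f 0 (diff C (0 + 1) 0 x)) = 0.
      by rewrite f0; apply/augC; exists x.
    by exists z.
  have [l jl] : exists l, j = l + 1 by exists (j - 1); rewrite subrK.
  apply: (exD _ _ _ ij jl); first by lia.
  by rewrite -fc ?diff_comp ?linear0 //; lia.
exists (update f e); split=> [x|n p np p_ge0 p_lt x].
  by rewrite update_other //; apply/eqP; lia.
have [ni|ni] := eqVneq i n.
  have pj : p = j by lia.
  clear np; subst n p; rewrite update_same update_other; last by apply/eqP; lia.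
  by rewrite -eE.
by rewrite !update_other ?fc //; move/eqP: ni; lia.
Qed.

Lemma resolution_homotopy (X : lmodType A) C (eps : {linear C 0 -> X}) (f : family C C)
    (m : nat) :
  (forall i, free_module (C i)) -> augmentation eps ->
  (forall i : int, i < 0 -> is_zero (C i)) ->
  (forall i j l : int, i = j + 1 -> j = l + 1 -> 0 < j -> exact_at C i j l) ->
  (forall x, eps (f 0 x) = 0) ->
  (forall i j, i = j + 1 -> 0 <= j -> j < m%:Z -> commutes_at f i j) ->
  exists h : homotopy C, forall i j l, i = j + 1 -> j = l + 1 -> 0 <= j -> j < m%:Z ->
    homotopy_at f h i j l.
Proof.
move=> freeC [_ augC] C0 exC f0.
elim: m => [|m IH] fc; first by exists (fun p => (\0 : {linear C p.1 -> C p.2})) => i j l _ _; lia.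
have [i j ij j_ge0 j_lt|h hc] := IH; first by apply: fc => //; lia.
have [j jE] : exists j, j = m%:Z by eexists.
have [i ij] : exists i, i = j + 1 by eexists.
have [l jl] : exists l, j = l + 1 by exists (j - 1); rewrite subrK.
have [x|e eE] := free_lift (d := diff C i j) (f := f j \- (h (l, j) \o diff C j l)) (freeC j).
  rewrite /=; case: m fc jE hc {IH} => [|m] fc jE hc.
    (* Here [j] is 0, so the target lies in degree -1, where the resolution vanishes; only the
       augmentation is left to supply the preimage. *)
    have -> : diff C j l x = 0 by apply: C0; lia.
    rewrite linear0 subr0; clear jl; subst i j.
    by have /augC[z zE] := f0 x; exists z.
  apply: (exC _ _ _ ij jl); first by lia.
  have [n ln] : exists n, l = n + 1 by exists (l - 1); rewrite subrK.
  rewrite linearB /= -fc //; try lia.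
  rewrite (hc j l n) //; try lia.
  by rewrite diff_comp linear0 addr0 subrr.
exists (@update _ _ h (j, i) e) => i' j' l' ij' jl' j_ge0 j_lt x.
have U1 : (j, i) != (l', j').
  by rewrite xpair_eqE; apply/nandP; left; apply/eqP; lia.
rewrite [update _ _ (l', j')]update_other //.
have [jj'|jj'] := eqVneq j j'.
  have ii' : i' = i by lia.
  have ll' : l' = l by lia.
  clear ij' jl'; subst j' i' l'; rewrite update_same.
  by rewrite -eE /= subrK.
rewrite update_other; last by rewrite xpair_eqE (negPf jj').
by apply: hc => //; move/eqP: jj'; lia.
Qed.

Lemma resolution_exact (X : lmodType A) F : free_resolution X F ->
  exists eps : {linear F 0 -> X}, augmentation eps /\
  forall i j l : int, i = j + 1 -> j = l + 1 -> 0 < j -> exact_at F i j l.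
Proof.
move=> [_ _ exF [eps augF]]; exists eps; split=> // i j l ij jl j_gt0.
by apply/homology_exact => //; apply: exF.
Qed.

Lemma acyclic_hom_exact C (W : lmodType A) : acyclic (hom_complex C A^o) ->
  finite_free W -> forall i j l, i = j + 1 -> j = l + 1 -> hom_exact C W i j l.
Proof.
move=> acC freeW i j l ij jl; apply: hom_exact_free => //.
exact/(@tate_ext_exact _ C A^o i j l ij jl)/acC.
Qed.

Lemma iso_from_inverse C D (n : int) : iso_from n C D ->
  exists (phi : family C D) (psi : family D C),
  [/\ forall i, n <= i -> cancel (phi i) (psi i),
      forall i, n <= i -> cancel (psi i) (phi i),
      forall i j, i = j + 1 -> n <= j -> commutes_at phi i j &
      forall i j, i = j + 1 -> n <= j -> commutes_at psi i j].
Proof.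
move=> [phi [bij com]].
have inv i : exists psi : {linear D i -> C i}, n <= i -> cancel (phi i) psi /\ cancel psi (phi i).
  case: (boolP (n <= i)) => [/bij/linear_inverse[psi psiP]|_]; first by exists psi.
  (* Below [n] nothing is claimed, and zero is a placeholder. *)
  by exists \0.
pose psi i := projT1 (cid (inv i)).
have psiP i : n <= i -> cancel (phi i) (psi i) /\ cancel (psi i) (phi i).
  exact: (projT2 (cid (inv i))).
have comp i j : i = j + 1 -> n <= j -> commutes_at phi i j by move=> ->; apply: com.
exists phi, psi; split=> // [i /psiP[]|i /psiP[]|i j ij nj x] //.
have [phiK psiK] := psiP j nj.
have /psiP[_ psiKi] : n <= i by lia.
by apply: (can_inj phiK); rewrite psiK comp // psiKi.
Qed.

(** The comparison maps and the homotopy of the two free resolutions are transported to [C] and [D]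
    in a window of high degrees by the isomorphisms, then extended downwards by [chain_down] and
    [homotopy_down] until they pass [l]. *)
Lemma complete_resolution_retract (X : lmodType A) C D :
  complete_resolution X C -> complete_resolution X D ->
  forall i j l, i = j + 1 -> j = l + 1 -> retract C D i j l.
Proof.
move=> [freeC _ homC [F [resF [n /iso_from_inverse[p [q [pK qK pc qc]]]]]]].
move=> [freeD _ homD [F' [resF' [n' /iso_from_inverse[p' [q' [p'K q'K p'c q'c]]]]]]].
move=> i j l ij jl.
have [eps [aug exF]] := resolution_exact resF.
have [eps' [aug' exF']] := resolution_exact resF'.
have [freeF F0 _ _] := resF; have [freeF' _ _ _] := resF'.
(* Above [N] both complexes agree with their resolutions. The window from [N] to [N + 3] is wide
   enough to start the homotopy, and [2 * N] steps down end at degree -N, which is below [l]. *)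
have [N [nN n'N lN]] : exists N : nat, [/\ n <= N%:Z, n' <= N%:Z & `|l| + 2 <= N%:Z].
  by exists (`|n| + `|n'| + `|l| + 2)%N; split; lia.
have [f [f0 fc]] := resolution_chain_map freeF aug aug' exF' (N + 3).
have [g [g0 gc]] := resolution_chain_map freeF' aug' aug exF (N + 3).
pose fg : family F F := fun i => (g i \o f i) \- idfun.
have fg0 x : eps (fg 0 x) = 0 by rewrite linearB /= g0 f0 subrr.
have fgc a b : a = b + 1 -> 0 <= b -> b < (N + 3)%N%:Z -> commutes_at fg a b.
  by move=> ab b0 bN x; rewrite /= fc // gc // linearB.
have [h hc] := resolution_homotopy freeF aug F0 exF fg0 fgc.
pose f1 : family C D := fun i => q' i \o (f i \o p i).
pose g1 : family D C := fun i => q i \o (g i \o p' i).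
have f1c a b : a = b + 1 -> N%:Z <= b -> b < (N + 3)%N%:Z -> commutes_at f1 a b.
  by move=> ab Nb bN x; rewrite /= pc ?fc ?q'c //; lia.
have g1c a b : a = b + 1 -> N%:Z <= b -> b < (N + 3)%N%:Z -> commutes_at g1 a b.
  by move=> ab Nb bN x; rewrite /= p'c ?gc ?qc //; lia.
have N3 : N%:Z < (N + 3)%N%:Z by lia.
have [f2 [f2E f2c]] := chain_down (fun a b c ab bc => acyclic_hom_exact homC (freeD c) ab bc)
  N3 f1c (2 * N).
have [g2 [g2E g2c]] := chain_down (fun a b c ab bc => acyclic_hom_exact homD (freeC c) ab bc)
  N3 g1c (2 * N).
pose h1 : homotopy C := fun ab => q ab.2 \o (h ab \o p ab.1).
pose fg2 : family C C := fun i => (g2 i \o f2 i) \- idfun.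
have fg2c a b : a = b + 1 -> N%:Z - (2 * N)%N%:Z <= b -> b < (N + 3)%N%:Z -> commutes_at fg2 a b.
  by move=> ab Nb bN x; rewrite /= f2c // g2c // linearB.
have N4 : N%:Z + 1 < (N + 3)%N%:Z by lia.
have h1c a b c : a = b + 1 -> b = c + 1 -> N%:Z <= c -> b < (N + 3)%N%:Z ->
    homotopy_at fg2 h1 a b c.
  move=> ab bc Nc bN x; rewrite /= f2E ?g2E; try lia.
  rewrite /= q'K; last by lia.
  have := hc a b c ab bc _ bN (p b x); rewrite /= => hE.
  rewrite -[X in _ - X](pK b); last by lia.
  rewrite -linearB hE; try lia.
  by rewrite linearD /= qc ?pc //; lia.
have [h2 h2c] := homotopy_down (fun a b c ab bc => acyclic_hom_exact homC (freeC b) ab bc)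
  N4 fg2c h1c.
by exists f2, g2, h2; split; [apply: f2c|apply: g2c|apply: h2c] => //; lia.
Qed.

Lemma tate_ext_indep (X Y : lmodType A) C D i :
  complete_resolution X C -> complete_resolution X D ->
  is_zero (tate_ext D Y i) -> is_zero (tate_ext C Y i).
Proof.
move=> resC resD; have [l il] : exists l, i = l + 1 by exists (i - 1); rewrite subrK.
rewrite !(@tate_ext_exact _ _ _ (i + 1) i l) //.
by apply: retract_hom; apply: complete_resolution_retract resC resD _ _ _ _ _.
Qed.

Lemma tate_tor_indep (X Y : lmodType A) C D i :
  complete_resolution X C -> complete_resolution X D ->
  is_zero (tate_tor D Y i) -> is_zero (tate_tor C Y i).
Proof.
move=> resC resD; have [l il] : exists l, i = l + 1 by exists (i - 1); rewrite subrK.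
rewrite !(@tate_tor_exact _ _ _ (i + 1) i l) //.
by apply: retract_tensor; apply: complete_resolution_retract resC resD _ _ _ _ _.
Qed.

End Comparison.

(** * Complexes of matrices *)

Section TensorEval.

Variables (A : comNzRingType) (U N : lmodType A) (pi : {linear U -> A^o}).

(** On simple tensors this is pi(w) n, that is, [pi] tensored with N followed by the identification
    of A tensor N with N. For [pi] a coordinate function it yields the components of the isomorphism
    from A^p tensor N to N^p. *)
Definition tensor_eval_pre : {linear {malg A[(U * N)%type]} -> N} :=
  malg_lift (fun w : U * N => (pi w.1 : A) *: w.2).

Fact tensor_eval_preP g : tensor_rel g -> tensor_eval_pre g = 0.
Proof.
have piZ a w : pi (a *: w) = a * pi w :> A by rewrite linearZ.
case=> *; rewrite /tensor_eval_pre ?linearB ?linearZ /= !malg_liftU /=.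
- by rewrite linearD scalerDl addrAC addrK subrr.
- by rewrite scalerDr addrAC addrK subrr.
- by rewrite piZ scalerN scalerA subrr.
- by rewrite scalerN !scalerA mulrC subrr.
Qed.

Definition tensor_eval : {linear tensor U N -> N} := qlift tensor_eval_preP.

Lemma tensor_evalE w n : tensor_eval (tens w n) = (pi w : A) *: n.
Proof. by rewrite /tensor_eval /tens [LHS]qliftE /tensor_eval_pre /= malg_liftU. Qed.

Lemma tens_sum (I : Type) (s : seq I) (F : I -> U) (n : N) :
  tens (\sum_(i <- s) F i) n = \sum_(i <- s) tens (F i) n.
Proof.
elim: s => [|i s IH]; last by rewrite !big_cons tensDl IH.
by rewrite !big_nil -(scale0r 0) tensZl scale0r.
Qed.

End TensorEval.

Section MatrixComplex.

Variable A : comNzRingType.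

Lemma cV_expand p (w : 'cV[A]_p) : w = \sum_i w i 0 *: delta_mx i 0.
Proof.
rewrite [LHS]matrix_sum_delta; apply: eq_bigr => i _.
by rewrite big_ord1.
Qed.

Lemma free_cV p : free_module 'cV[A]_p.
Proof.
pose f : {linear {malg A['I_p]} -> 'cV[A]_p} := malg_lift (fun i => delta_mx i 0).
pose g (w : 'cV[A]_p) : {malg A['I_p]} := \sum_i w i 0 *: << i >>.
have lin_g : linear g.
  move=> a w w'; rewrite /g scaler_sumr -big_split; apply: eq_bigr => i _.
  by rewrite !mxE scalerDl scalerA.
have [g' gE] := linear_of lin_g.
have gd i : g (delta_mx i 0) = << i >>.
  rewrite /g (bigD1 i) //= mxE !eqxx scale1r big1 ?addr0 // => j /negPf ji.
  by rewrite mxE ji scale0r.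
exists 'I_p, f, g' => [m|w].
  apply: (malg_ext (f := g' \o f) (g := idfun)) => i /=.
  by rewrite malg_liftU gE gd.
rewrite gE /g linear_sum [RHS]cV_expand; apply: eq_bigr => i _.
by rewrite linearZ /= malg_liftU.
Qed.

Lemma finite_free_cV p : finite_free 'cV[A]_p.
Proof.
exists p, (@trmx A 1 p : {linear 'rV[A]_p -> 'cV[A]_p}).
by exists (@trmx A p 1); exact: trmxK.
Qed.

Variables (rk : int -> nat) (ent : int -> nat -> nat -> A).

(** Entries indexed by natural numbers fit any size, so a matrix exists for each pair of degrees
    without transport along equations between ranks. *)
Definition mat (i j : int) : 'M[A]_(rk j, rk i) :=
  \matrix_(r, s) if i == j + 1 then ent j r s else 0.

Hypothesis mat_comp : forall i j l, i = j + 1 -> j = l + 1 -> mat j l *m mat i j = 0.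

Definition cpx_obj (i : int) : lmodType A := 'cV[A]_(rk i).
Definition cpx_diff (i j : int) : {linear cpx_obj i -> cpx_obj j} := mulmx (mat i j).

Lemma mat_shape i j : i != j + 1 -> mat i j = 0.
Proof. by move=> /negPf ij; apply/matrixP => r s; rewrite !mxE ij. Qed.

Fact cpx_shape i j : i != j + 1 -> forall x, cpx_diff i j x = 0.
Proof. by move=> ij x; rewrite /cpx_diff /= mat_shape // mul0mx. Qed.

Fact cpx_comp i j l x : cpx_diff j l (cpx_diff i j x) = 0.
Proof.
have [ij|ij] := eqVneq i (j + 1); last by rewrite (cpx_shape ij) linear0.
have [jl|jl] := eqVneq j (l + 1); last by rewrite (cpx_shape jl).
by rewrite /cpx_diff /= mulmxA mat_comp // mul0mx.
Qed.

Definition mx_complex : complex A := Complex cpx_shape cpx_comp.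

Lemma mx_complex_exact_at i j l :
  exact_mx (mat j l) (mat i j) -> exact_at mx_complex i j l.
Proof. by move=> [_ ex] x /ex[w wE]; exists w. Qed.

Section Coefficients.

Variable N : lmodType A.

Definition mx_act p q (B : 'M[A]_(q, p)) (n : 'I_p -> N) (r : 'I_q) : N :=
  \sum_s B r s *: n s.

Definition mod_exact p q r (B : 'M[A]_(r, q)) (C : 'M[A]_(q, p)) :=
  forall n, (forall i, mx_act B n i = 0) -> exists m, forall i, n i = mx_act C m i.

Lemma linear_cVE p (xi : {linear 'cV[A]_p -> N}) w :
  xi w = \sum_i w i 0 *: xi (delta_mx i 0).
Proof.
by rewrite {1}[w]cV_expand linear_sum; apply: eq_bigr => i _; rewrite linearZ.
Qed.

Lemma linear_cV_of p (n : 'I_p -> N) :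
  exists xi : {linear 'cV[A]_p -> N}, forall w, xi w = \sum_i w i 0 *: n i.
Proof.
apply: linear_of => a w w'; rewrite scaler_sumr -big_split; apply: eq_bigr => i _.
by rewrite !mxE scalerDl scalerA.
Qed.

Lemma linear_cV_mulmx p q (B : 'M[A]_(q, p)) (xi : {linear 'cV[A]_q -> N}) s :
  xi (B *m delta_mx s 0) = mx_act B^T (fun r => xi (delta_mx r 0)) s.
Proof.
by rewrite linear_cVE -colE; apply: eq_bigr => r _; rewrite !mxE.
Qed.

Lemma eq_mx_act p q (B : 'M[A]_(q, p)) (n n' : 'I_p -> N) r :
  n =1 n' -> mx_act B n r = mx_act B n' r.
Proof. by move=> e; apply: eq_bigr => s _; rewrite e. Qed.

(** A map A^p -> N is the family of its values on the unit vectors, and precomposition with a matrix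
    acts on such families by the transpose. *)
Lemma hom_exact_mx i j l :
  hom_exact mx_complex N i j l <-> mod_exact (mat i j)^T (mat j l)^T.
Proof.
split=> ex.
  move=> n n0; have [xi xiE] := linear_cV_of n.
  have xid r : xi (delta_mx r 0) = n r.
    rewrite xiE (bigD1 r) //= mxE !eqxx scale1r big1 ?addr0 // => s /negPf sr.
    by rewrite mxE sr scale0r.
  have [x|eta etaE] := ex xi.
    rewrite /= /cpx_diff /= [x]cV_expand linear_sum linear_sum big1 // => s _.
    rewrite !linearZ /= linear_cV_mulmx (eq_mx_act _ _ xid).
    by rewrite n0 scaler0.
  exists (fun q => eta (delta_mx q 0)) => r.
  by rewrite -xid etaE /= /cpx_diff /= linear_cV_mulmx.
move=> xi xi0.
have [s|m mE] := ex (fun r => xi (delta_mx r 0)).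
  by rewrite -linear_cV_mulmx; apply: xi0.
have [eta etaE] := linear_cV_of m; exists eta => x.
rewrite etaE linear_cVE /= /cpx_diff /=.
rewrite (eq_bigr (fun r => \sum_s (x r 0 * mat j l s r) *: m s)); last first.
  by move=> r _; rewrite mE scaler_sumr; apply: eq_bigr => s _;
    rewrite scalerA [(mat _ _)^T _ _]mxE.
rewrite exchange_big; apply: eq_bigr => s _; rewrite -scaler_suml mxE.
by congr (_ *: _); apply: eq_bigr => r _; rewrite mulrC.
Qed.

Section TensorCoordinates.

Variables (p : nat).

Fact cV_coord_linear (r : 'I_p) : linear (fun w : 'cV[A]_p => w r 0 : A^o).
Proof. by move=> a w w'; rewrite !mxE. Qed.

Definition cV_coord (r : 'I_p) : {linear 'cV[A]_p -> A^o} :=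
  projT1 (cid (linear_of (cV_coord_linear r))).

Definition tcoord r : {linear tensor 'cV[A]_p N -> N} := tensor_eval N (cV_coord r).

Lemma tcoordE r w n : tcoord r (tens w n) = w r 0 *: n.
Proof.
apply: etrans (tensor_evalE _ _ _) _; congr (_ *: _).
exact: (projT2 (cid (linear_of (cV_coord_linear r)))).
Qed.

End TensorCoordinates.

Lemma tensor_cV p (x : tensor 'cV[A]_p N) :
  x = \sum_r tens (delta_mx r 0) (tcoord r x).
Proof.
have lin : linear (fun x : tensor 'cV[A]_p N => \sum_r tens (delta_mx r (0 : 'I_1)) (tcoord r x)).
  move=> a y y'; rewrite scaler_sumr -big_split; apply: eq_bigr => r _.
  by rewrite linearP tensDr tensZr.
have [g gE] := linear_of lin.
apply: etrans (gE x); apply: (tensor_ind (f := idfun) (g := g)) => u n.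
change (tens u n = g (tens u n)).
rewrite gE [u in LHS]cV_expand tens_sum; apply: eq_bigr => r _.
by rewrite tcoordE tensZl tensZr.
Qed.

Lemma tcoord_map p q (B : {linear 'cV[A]_p -> 'cV[A]_q}) (M : 'M[A]_(q, p)) x r :
  (forall w, B w = M *m w) ->
  tcoord r (tensor_map N B x) = mx_act M (fun s => tcoord s x) r.
Proof.
move=> BE.
have lin : linear (fun x => mx_act M (fun s => tcoord s x) r).
  move=> a y y'; rewrite /mx_act scaler_sumr -big_split; apply: eq_bigr => s _.
  by rewrite linearP scalerDr !scalerA mulrC.
have [g gE] := linear_of lin.
rewrite -gE; apply: (tensor_ind (f := tcoord r \o tensor_map N B)) => u n.
apply: etrans (congr1 (tcoord r) (tensor_mapE _ _ _)) _.
rewrite tcoordE BE gE mxE scaler_suml; apply: eq_bigr => s _.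
by rewrite tcoordE scalerA.
Qed.

Lemma tcoord_eq p (x y : tensor 'cV[A]_p N) : (forall r, tcoord r x = tcoord r y) -> x = y.
Proof.
by move=> e; rewrite [x]tensor_cV [y]tensor_cV; apply: eq_bigr => r _; rewrite e.
Qed.

Lemma tcoord_of p (n : 'I_p -> N) : exists x : tensor 'cV[A]_p N, forall r, tcoord r x = n r.
Proof.
exists (\sum_r tens (delta_mx r 0) (n r)) => r.
have E s : tcoord r (tens (delta_mx s 0) (n s)) = (r == s)%:R *: n s.
  by rewrite tcoordE mxE eqxx andbT.
rewrite linear_sum (eq_bigr _ (fun s _ => E s)) (bigD1 r) //= eqxx scale1r.
by rewrite big1 ?addr0 // => s; rewrite eq_sym => /negPf->; rewrite scale0r.
Qed.

Lemma tensor_exact_mx i j l :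
  exact_at (tensor_complex mx_complex N) i j l <-> mod_exact (mat j l) (mat i j).
Proof.
have dE a b (x : tensor_obj mx_complex N a) (r : 'I_(rk b)) :
    tcoord r (tensor_diff mx_complex N a b x) = mx_act (mat a b) (fun s => tcoord s x) r.
  by apply: tcoord_map.
split=> ex.
  move=> n n0; have [x xE] := tcoord_of n.
  have [|y yE] := ex x.
    apply: (@tcoord_eq (rk l)) => r; rewrite linear0; apply: etrans (dE _ _ _ _) _.
    by rewrite (eq_mx_act _ _ xE) n0.
  exists (fun s => tcoord s y) => r; rewrite -xE; apply: etrans (dE _ _ _ _).
  exact: (congr1 (tcoord r) yE).
move=> x x0; have [r|m mE] := ex (fun r => tcoord r x).
  apply: etrans (esym (dE _ _ _ _)) _.
  by apply: etrans (congr1 (tcoord r) x0) _; rewrite linear0.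
have [y yE] := tcoord_of m; exists y; apply: (@tcoord_eq (rk j)) => r.
by rewrite mE; apply: etrans (esym (dE _ _ _ _)); apply: eq_mx_act => s; rewrite yE.
Qed.

End Coefficients.

Lemma mx_complex_dual_acyclic i j l :
  exact_mx (mat i j)^T (mat j l)^T -> hom_exact mx_complex A^o i j l.
Proof.
move=> [_ ex]; apply/hom_exact_mx => n n0.
have [|w wE] := ex (\col_r n r).
  by apply/colP => s; rewrite !mxE -[RHS](n0 s); apply: eq_bigr => r _; rewrite !mxE.
exists (fun q => w q 0) => r; have /colP/(_ r) := wE; rewrite mxE => ->.
by rewrite mxE; apply: eq_bigr.
Qed.

End MatrixComplex.

From mathcomp Require Import mpoly.

(** * The ring R *)

Section TheRing.

Variables (k : fieldType) (alpha : k).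
Local Notation R := (quadric_ring alpha).
Local Notation P := {mpoly k[6]}.
Local Open Scope quotient_scope.

Lemma residue_is_zmod_morphism : zmod_morphism (residue alpha).
Proof. exact: (raddfB (\pi_({ideal_quot quadric_ideal alpha}))). Qed.
HB.instance Definition _ :=
  GRing.isZmodMorphism.Build P R (residue alpha) residue_is_zmod_morphism.

Lemma residue_is_monoid_morphism : monoid_morphism (residue alpha).
Proof.
split; first exact: (rmorph1 (\pi_({ideal_quot quadric_ideal alpha}))).
exact: (rmorphM (\pi_({ideal_quot quadric_ideal alpha}))).
Qed.
HB.instance Definition _ :=
  GRing.isMonoidMorphism.Build P R (residue alpha) residue_is_monoid_morphism.

Definition kappa (c : k) : R := residue alpha c%:MP.

HB.instance Definition _ := GRing.RMorphism.copy kappa (residue alpha \o @mpolyC 6 k).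

Definition gen (i : 'I_6) : R := residue alpha 'X_i.

Lemma residueZ c f : residue alpha (c *: f) = kappa c * residue alpha f.
Proof. by rewrite -mul_mpolyC rmorphM. Qed.

Lemma residue_eq0 f : residue alpha f = 0 -> f \in quadric_ideal alpha.
Proof.
move=> f0; rewrite -[f]subr0 Quotient.idealrBE; apply/eqP.
by rewrite [LHS]f0 -[LHS](rmorph0 (residue alpha)).
Qed.

(* The value, on the cubic monomial in T, U, V, X, Y, Z with the given exponents,
   of the linear form on cubics that vanishes on the degree 3 part of the ideal,
   normalised by TVX |-> 1; it was found by solving the linear system given by
   the products of a variable and a quadric. *)
Definition exponent_weight (a b c d e f : nat) : k :=
  match a, b, c, d, e, f with
  | 2, 0, 0, 0, 1, 0 => 1%R
  | 2, 0, 0, 0, 0, 1 => (- (alpha + 1))%R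
  | 1, 0, 1, 1, 0, 0 => 1%R
  | 1, 0, 0, 1, 0, 1 => (- alpha)%R
  | 0, 1, 1, 0, 0, 1 => 1%R
  | 0, 0, 1, 2, 0, 0 => 1%R
  | 0, 0, 1, 0, 2, 0 => 1%R
  | 0, 0, 0, 3, 0, 0 => 1%R
  | 0, 0, 0, 2, 0, 1 => (- alpha)%R
  | 0, 0, 0, 0, 2, 1 => (-1)%R
  | _, _, _, _, _, _ => 0%R
  end%N.

Definition weight (m : 'X_{1..6}) : k :=
  exponent_weight (m (@Ordinal 6 0 isT)) (m (@Ordinal 6 1 isT))
    (m (@Ordinal 6 2 isT)) (m (@Ordinal 6 3 isT)) (m (@Ordinal 6 4 isT))
    (m (@Ordinal 6 5 isT)).

Lemma mdeg6 (m : 'X_{1..6}) : mdeg m =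
  (m (@Ordinal 6 0 isT) + (m (@Ordinal 6 1 isT) +
    (m (@Ordinal 6 2 isT) + (m (@Ordinal 6 3 isT) + (m (@Ordinal 6 4 isT) +
    m (@Ordinal 6 5 isT))))))%N.
Proof.
rewrite mdegE !big_ord_recl big_ord0 addn0.
by do !congr (_ + _)%N; congr (_ _); apply: val_inj.
Qed.

Lemma weight_deg m : mdeg m != 3%N -> weight m = 0.
Proof.
rewrite mdeg6 /weight; move: (m _) (m _) (m _) (m _) (m _) (m _).
by move=> [|[|f]] [|[|[|e]]] [|[|[|[|d]]]] [|[|c]] [|[|b]] [|[|[|a]]] // /negP[].
Qed.

(** The functional given by a Macaulay inverse system of degree 3. Since [weight] vanishes off
    degree 3, summing over monomials of degree below 4 loses nothing. *)
Definition macaulay (f : P) : k := \sum_(m : 'X_{1..6 < 4}) f@_m * weight m.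

Lemma macaulayZ c f : macaulay (c *: f) = c * macaulay f.
Proof. by rewrite mulr_sumr; apply: eq_bigr => m _; rewrite mcoeffZ mulrA. Qed.

Lemma macaulay_zmod : zmod_morphism macaulay.
Proof.
move=> f g; rewrite -sumrB; apply: eq_bigr => m _.
by rewrite mcoeffB mulrBl.
Qed.
HB.instance Definition _ :=
  GRing.isZmodMorphism.Build P k macaulay macaulay_zmod.

Lemma macaulayD : {morph macaulay : f g / f + g}.
Proof. exact: raddfD. Qed.

Lemma macaulayN : {morph macaulay : f / - f}.
Proof. exact: raddfN. Qed.

Lemma macaulayX m : macaulay 'X_[m] = weight m.
Proof.
have [m3|m3] := eqVneq (mdeg m) 3%N; last first.
  rewrite weight_deg // /macaulay big1 // => i _; rewrite mcoeffX.
  by case: eqP => [<-|_]; rewrite ?mul0r // mul1r weight_deg.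
have lt_m : (mdeg m < 4)%N by rewrite m3.
rewrite /macaulay (bigD1 (BMultinom lt_m)) //= mcoeffX eqxx mul1r big1 ?addr0 //.
move=> i ne; rewrite mcoeffX; case: eqP => [e|_]; last by rewrite mul0r.
by case/eqP: ne; apply: val_inj.
Qed.

Lemma macaulay_monoXX m i j :
  macaulay ('X_[m] * ('X_i * 'X_j)) = weight (m + (U_(i) + U_(j)))%MM.
Proof. by rewrite -!mpolyXD macaulayX. Qed.

Lemma weight_add2 m i j :
  mdeg m != 1%N -> weight (m + (U_(i) + U_(j)))%MM = 0.
Proof.
by move=> m1; rewrite weight_deg // !mdegD !mdeg1 addn2 !eqSS.
Qed.

Lemma weight_XXX (i j l : 'I_6) : weight (U_(i) + (U_(j) + U_(l)))%MM =
  let e (a : nat) := ((i == a :> nat) + ((j == a :> nat) + (l == a :> nat)))%N in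
  exponent_weight (e 0) (e 1) (e 2) (e 3) (e 4) (e 5).
Proof. by rewrite /weight !mnmDE !mnm1E. Qed.

(** By linearity [f] is a monomial. The quadrics are homogeneous of degree 2, so only variables can
    contribute, which leaves six identities for each of the fifteen quadrics. *)
Lemma macaulay_quadric f i : macaulay (f * tnth (quadrics alpha) i) = 0.
Proof.
rewrite [f]mpolyE mulr_suml raddf_sum big1 // => m _.
rewrite -scalerAl /= macaulayZ; apply/eqP; rewrite mulf_eq0; apply/orP; right.
have E : forall q, q \in quadrics alpha -> macaulay ('X_[m] * q) == 0; last first.
  by apply: E; apply: mem_tnth.
move=> q; rewrite !inE; do 14?[case/orP]; move/eqP->;
  rewrite ?expr2 ?(mulrDr, mulrN) -?scalerAr ?(macaulayD, macaulayN) ?macaulayZ ?macaulay_monoXX.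
all: have [/mdeg1P[j /eqP->]|m1] := boolP (mdeg m == 1%N);
  last rewrite ?weight_add2 // ?(mulr0, oppr0, addr0).
all: try by [].
all: case: j => [[|[|[|[|[|[|//]]]]]] lt_j].
all: rewrite !weight_XXX /=.
all: apply/eqP; ring.
Qed.

Lemma macaulay_ideal f : residue alpha f = 0 -> macaulay f = 0.
Proof.
move/residue_eq0/asboolP => [a ->].
by rewrite raddf_sum big1 // => i _; apply: macaulay_quadric.
Qed.

Definition socle_form (r : R) : k := macaulay (repr r).

Lemma socle_formE f : socle_form (residue alpha f) = macaulay f.
Proof.
apply/eqP; rewrite -subr_eq0 -raddfB; apply/eqP/macaulay_ideal.
by rewrite raddfB /= {1}/residue reprK subrr.
Qed.

Lemma residueK : cancel repr (residue alpha).
Proof. by move=> r; rewrite /residue reprK. Qed.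

Lemma socle_form_zmod : zmod_morphism socle_form.
Proof.
move=> r s; rewrite -[r]residueK -[s]residueK -rmorphB !socle_formE.
exact: raddfB.
Qed.
HB.instance Definition _ :=
  GRing.isZmodMorphism.Build R k socle_form socle_form_zmod.

Lemma socle_formZ c r : socle_form (kappa c * r) = c * socle_form r.
Proof. by rewrite -[r]residueK -residueZ !socle_formE macaulayZ. Qed.

Definition res_t : R := gen (@Ordinal 6 0 isT).
Local Notation t := res_t.
Definition res_u : R := gen (@Ordinal 6 1 isT).
Local Notation u := res_u.
Definition res_v : R := gen (@Ordinal 6 2 isT).
Local Notation v := res_v.
Definition res_x : R := gen (@Ordinal 6 3 isT).
Local Notation x := res_x.
Definition res_y : R := gen (@Ordinal 6 4 isT).
Local Notation y := res_y.
Definition res_z : R := gen (@Ordinal 6 5 isT).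
Local Notation z := res_z.
Local Notation al := (kappa alpha).

(** * Relations, monomial basis and multiplication table of R *)

Lemma residue_quadric i : residue alpha (tnth (quadrics alpha) i) = 0.
Proof.
rewrite -[RHS](rmorph0 (residue alpha)); apply/eqP.
rewrite -[_ == _]Quotient.idealrBE subr0; apply/asboolP.
exists (fun j => (j == i)%:R); rewrite (bigD1 i) //= eqxx mul1r big1 ?addr0 //.
by move=> j /negPf->; rewrite mul0r.
Qed.

Lemma socle_form_socle : socle_form (t * v * x) = 1.
Proof.
rewrite /t /v /x /gen -!rmorphM socle_formE -!mpolyXD macaulayX /weight.
by rewrite !mnmDE !mnm1E.
Qed.

Lemma socle_form_low (m : 'X_{1..6}) :
  mdeg m != 3%N -> socle_form (residue alpha 'X_[m]) = 0.
Proof. by move=> m3; rewrite socle_formE macaulayX weight_deg. Qed.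

Local Ltac from_quadric i :=
  apply/eqP; rewrite -subr_eq0; apply/eqP;
  rewrite -[RHS](residue_quadric (@Ordinal 15 i isT)) /tnth /=
    ?(rmorphB, rmorphD) /= ?residueZ ?rmorphXn ?rmorphM /=
    ?(rmorphB, rmorphD, rmorph1) /= -/(gen _) -/t -/u -/v -/x -/y -/z.

Lemma rel_zz : z * z = 0.
Proof. by from_quadric 0%N; ring. Qed.

Lemma rel_uu : u * u = 0.
Proof. by from_quadric 2%N; ring. Qed.

Lemma rel_yz : y * z = - (v * y).
Proof. by from_quadric 3%N; ring. Qed.

Lemma rel_uy : u * y = 0.
Proof. by from_quadric 4%N; ring. Qed.

Lemma rel_xz : x * z = - al * (v * x).
Proof. by from_quadric 6%N; ring. Qed.

Lemma rel_ux : u * x = 0.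
Proof. by from_quadric 7%N; ring. Qed.

Lemma rel_xy : x * y = 0.
Proof. by from_quadric 8%N; ring. Qed.

Lemma rel_uz : u * z = t * x + al * (u * v).
Proof. by from_quadric 1%N; ring. Qed.

Lemma rel_yy : y * y = t * x + (al - 1) * (u * v).
Proof. by from_quadric 5%N; ring. Qed.

Lemma rel_xx : x * x = t * x + t * v.
Proof. by from_quadric 9%N; ring. Qed.

Lemma rel_ty : t * y = v * x - t * v.
Proof. by from_quadric 12%N; ring. Qed.

Lemma rel_tz : t * z = - (1 + al) * (v * x) + t * v.
Proof.
(* The quadric at hand expresses [t * z + t * y]; adding the relation for [t * y] eliminates that
   term. *)
have -> : t * z = t * z + (t * y - (v * x - t * v)) by rewrite rel_ty subrr addr0.
by from_quadric 10%N; ring.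
Qed.

Lemma rel_tu : t * u = 0.
Proof. by from_quadric 11%N; ring. Qed.

Lemma rel_tt : t * t = v * y - (1 + al) * (u * v).
Proof. by from_quadric 13%N; ring. Qed.

Lemma rel_vv : v * v = 0.
Proof. by from_quadric 14%N; ring. Qed.

(** The monomials are ordered by degree: index 0, then 1 to 6, 7 to 12, and 13 for the socle. Lists
    may be short, as missing coordinates default to zero. *)
Definition of_coords (l : seq k) : R :=
  kappa l`_0 + kappa l`_1 * t + kappa l`_2 * u + kappa l`_3 * v +
  kappa l`_4 * x + kappa l`_5 * y + kappa l`_6 * z +
  kappa l`_7 * (t * x) + kappa l`_8 * (t * v) + kappa l`_9 * (u * v) +
  kappa l`_10 * (v * x) + kappa l`_11 * (v * y) + kappa l`_12 * (v * z) +
  kappa l`_13 * (t * v * x).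

Lemma of_coordsD l1 l2 :
  of_coords l1 + of_coords l2 = of_coords [seq l1`_i + l2`_i | i <- iota 0 14].
Proof. by rewrite /of_coords /= !rmorphD; ring. Qed.

Lemma of_coordsZ c l : kappa c * of_coords l = of_coords [seq c * l`_i | i <- iota 0 14].
Proof. by rewrite /of_coords /= !rmorphM; ring. Qed.

Lemma mul_of_coords r l : r * of_coords l =
  kappa l`_0 * r + kappa l`_1 * (r * t) + kappa l`_2 * (r * u) +
  kappa l`_3 * (r * v) + kappa l`_4 * (r * x) + kappa l`_5 * (r * y) +
  kappa l`_6 * (r * z) + kappa l`_7 * (r * (t * x)) +
  kappa l`_8 * (r * (t * v)) + kappa l`_9 * (r * (u * v)) +
  kappa l`_10 * (r * (v * x)) + kappa l`_11 * (r * (v * y)) +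
  kappa l`_12 * (r * (v * z)) + kappa l`_13 * (r * (t * v * x)).
Proof. by rewrite /of_coords; ring. Qed.

Local Ltac mk_ring := rewrite /of_coords /=;
  move: (t * v * x) (t * x) (t * v) (u * v) (v * x) (v * y) (v * z) => *; ring.

(** With its five analogues this is the multiplication table of [R]. A variable times a quadratic
    basis monomial is regrouped until a defining quadric appears, and always reduces to a multiple
    of [t * v * x]. *)
Lemma t_of_coords l : t * of_coords l = of_coords [:: 0; l`_0; 0; 0; 0; 0; 0; l`_4;
  l`_3 - l`_5 + l`_6; - (1 + alpha) * l`_1; l`_5 - (1 + alpha) * l`_6;
  l`_1; 0; l`_10].
Proof.
have etx : t * (t * x) = 0.
  transitivity (x * (t * t)); first by ring.
  rewrite rel_tt.
  transitivity (v * (x * y) - (1 + al) * (v * (u * x))); first by ring.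
  rewrite rel_xy rel_ux.
  by ring.
have etv : t * (t * v) = 0.
  transitivity (v * (t * t)); first by ring.
  rewrite rel_tt.
  transitivity ((v * v) * (y - (1 + al) * u)); first by ring.
  rewrite rel_vv.
  by ring.
have euv : t * (u * v) = 0.
  transitivity (v * (t * u)); first by ring.
  rewrite rel_tu.
  by ring.
have evx : t * (v * x) = t * v * x.
  by ring.
have evy : t * (v * y) = 0.
  transitivity (v * (t * y)); first by ring.
  rewrite rel_ty.
  transitivity ((v * v) * (x - t)); first by ring.
  rewrite rel_vv.
  by ring.
have evz : t * (v * z) = 0.
  transitivity (v * (t * z)); first by ring.
  rewrite rel_tz.
  transitivity ((v * v) * (t - (1 + al) * x)); first by ring.
  rewrite rel_vv.
  by ring.
have es : t * (t * v * x) = 0.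
  transitivity (x * (v * (t * t))); first by ring.
  rewrite rel_tt.
  transitivity (x * ((v * v) * (y - (1 + al) * u))); first by ring.
  rewrite rel_vv.
  by ring.
by rewrite mul_of_coords etx etv euv evx evy evz es rel_tt rel_tu rel_ty rel_tz; mk_ring.
Qed.

Lemma u_of_coords l : u * of_coords l = of_coords [:: 0; 0; l`_0; 0; 0; 0; 0; l`_6; 0;
  l`_3 + alpha * l`_6; 0; 0; 0; l`_12].
Proof.
have etx : u * (t * x) = 0.
  transitivity (x * (t * u)); first by ring.
  rewrite rel_tu.
  by ring.
have etv : u * (t * v) = 0.
  transitivity (v * (t * u)); first by ring.
  rewrite rel_tu.
  by ring.
have euv : u * (u * v) = 0.
  transitivity (v * (u * u)); first by ring.
  rewrite rel_uu.
  by ring.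
have evx : u * (v * x) = 0.
  transitivity (v * (u * x)); first by ring.
  rewrite rel_ux.
  by ring.
have evy : u * (v * y) = 0.
  transitivity (v * (u * y)); first by ring.
  rewrite rel_uy.
  by ring.
have evz : u * (v * z) = t * v * x.
  transitivity (v * (u * z)); first by ring.
  rewrite rel_uz.
  transitivity (t * v * x + al * u * (v * v)); first by ring.
  rewrite rel_vv.
  by ring.
have es : u * (t * v * x) = 0.
  transitivity (v * x * (t * u)); first by ring.
  rewrite rel_tu.
  by ring.
by rewrite mul_of_coords etx etv euv evx evy evz es
  [u * t]mulrC rel_tu rel_uu rel_ux rel_uy rel_uz; mk_ring.
Qed.

Lemma v_of_coords l : v * of_coords l = of_coords [:: 0; 0; 0; l`_0; 0; 0; 0; 0; l`_1; l`_2;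
  l`_4; l`_5; l`_6; l`_7].
Proof.
have etx : v * (t * x) = t * v * x.
  by ring.
have etv : v * (t * v) = 0.
  transitivity (t * (v * v)); first by ring.
  rewrite rel_vv.
  by ring.
have euv : v * (u * v) = 0.
  transitivity (u * (v * v)); first by ring.
  rewrite rel_vv.
  by ring.
have evx : v * (v * x) = 0.
  transitivity (x * (v * v)); first by ring.
  rewrite rel_vv.
  by ring.
have evy : v * (v * y) = 0.
  transitivity (y * (v * v)); first by ring.
  rewrite rel_vv.
  by ring.
have evz : v * (v * z) = 0.
  transitivity (z * (v * v)); first by ring.
  rewrite rel_vv.
  by ring.
have es : v * (t * v * x) = 0.
  transitivity (t * x * (v * v)); first by ring.
  rewrite rel_vv.
  by ring.
by rewrite mul_of_coords etx etv euv evx evy evz es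
  [v * t]mulrC [v * u]mulrC rel_vv; mk_ring.
Qed.

Lemma x_of_coords l : x * of_coords l = of_coords [:: 0; 0; 0; 0; l`_0; 0; 0; l`_1 + l`_4; l`_4; 0;
  l`_3 - alpha * l`_6; 0; 0; l`_8 + l`_10].
Proof.
have etx : x * (t * x) = 0.
  transitivity (t * (x * x)); first by ring.
  rewrite rel_xx.
  transitivity ((x + v) * (t * t)); first by ring.
  rewrite rel_tt.
  transitivity (v * (x * y) - (1 + al) * v * (u * x) + (v * v) * (y - (1 + al) * u)); first by ring.
  rewrite rel_xy rel_ux rel_vv.
  by ring.
have etv : x * (t * v) = t * v * x.
  by ring.
have euv : x * (u * v) = 0.
  transitivity (v * (u * x)); first by ring.
  rewrite rel_ux.
  by ring.
have evx : x * (v * x) = t * v * x.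
  transitivity (v * (x * x)); first by ring.
  rewrite rel_xx.
  transitivity (t * v * x + t * (v * v)); first by ring.
  rewrite rel_vv.
  by ring.
have evy : x * (v * y) = 0.
  transitivity (v * (x * y)); first by ring.
  rewrite rel_xy.
  by ring.
have evz : x * (v * z) = 0.
  transitivity (v * (x * z)); first by ring.
  rewrite rel_xz.
  transitivity (- al * x * (v * v)); first by ring.
  rewrite rel_vv.
  by ring.
have es : x * (t * v * x) = 0.
  transitivity (t * v * (x * x)); first by ring.
  rewrite rel_xx.
  transitivity (t * (t * v * x) + t * t * (v * v)); first by ring.
  rewrite rel_vv.
  transitivity (x * v * (t * t)); first by ring.
  rewrite rel_tt.
  transitivity (x * (v * v) * (y - (1 + al) * u)); first by ring.
  rewrite rel_vv.
  by ring.
by rewrite mul_of_coords etx etv euv evx evy evz es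
  [x * t]mulrC [x * u]mulrC rel_ux [x * v]mulrC rel_xx rel_xy rel_xz; mk_ring.
Qed.

Lemma y_of_coords l : y * of_coords l = of_coords [:: 0; 0; 0; 0; 0; l`_0; 0; l`_5; - l`_1;
  (alpha - 1) * l`_5; l`_1; l`_3 - l`_6; 0; l`_11].
Proof.
have etx : y * (t * x) = 0.
  transitivity (t * (x * y)); first by ring.
  rewrite rel_xy.
  by ring.
have etv : y * (t * v) = 0.
  transitivity (v * (t * y)); first by ring.
  rewrite rel_ty.
  transitivity ((v * v) * (x - t)); first by ring.
  rewrite rel_vv.
  by ring.
have euv : y * (u * v) = 0.
  transitivity (v * (u * y)); first by ring.
  rewrite rel_uy.
  by ring.
have evx : y * (v * x) = 0.
  transitivity (v * (x * y)); first by ring.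
  rewrite rel_xy.
  by ring.
have evy : y * (v * y) = t * v * x.
  transitivity (v * (y * y)); first by ring.
  rewrite rel_yy.
  transitivity (t * v * x + (al - 1) * u * (v * v)); first by ring.
  rewrite rel_vv.
  by ring.
have evz : y * (v * z) = 0.
  transitivity (v * (y * z)); first by ring.
  rewrite rel_yz.
  transitivity (- y * (v * v)); first by ring.
  rewrite rel_vv.
  by ring.
have es : y * (t * v * x) = 0.
  transitivity (t * v * (x * y)); first by ring.
  rewrite rel_xy.
  by ring.
by rewrite mul_of_coords etx etv euv evx evy evz es
  [y * t]mulrC rel_ty [y * u]mulrC rel_uy [y * v]mulrC [y * x]mulrC rel_xy rel_yy rel_yz; mk_ring.
Qed.

Lemma z_of_coords l : z * of_coords l = of_coords [:: 0; 0; 0; 0; 0; 0; l`_0; l`_2; l`_1;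
  alpha * l`_2; - (1 + alpha) * l`_1 - alpha * l`_4; - l`_5; l`_3;
  l`_9 - alpha * l`_7].
Proof.
have etx : z * (t * x) = - al * (t * v * x).
  transitivity (t * (x * z)); first by ring.
  rewrite rel_xz.
  by ring.
have etv : z * (t * v) = 0.
  transitivity (v * (t * z)); first by ring.
  rewrite rel_tz.
  transitivity ((v * v) * (t - (1 + al) * x)); first by ring.
  rewrite rel_vv.
  by ring.
have euv : z * (u * v) = t * v * x.
  transitivity (v * (u * z)); first by ring.
  rewrite rel_uz.
  transitivity (t * v * x + al * u * (v * v)); first by ring.
  rewrite rel_vv.
  by ring.
have evx : z * (v * x) = 0.
  transitivity (v * (x * z)); first by ring.
  rewrite rel_xz.
  transitivity (- al * x * (v * v)); first by ring.
  rewrite rel_vv.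
  by ring.
have evy : z * (v * y) = 0.
  transitivity (v * (y * z)); first by ring.
  rewrite rel_yz.
  transitivity (- y * (v * v)); first by ring.
  rewrite rel_vv.
  by ring.
have evz : z * (v * z) = 0.
  transitivity (v * (z * z)); first by ring.
  rewrite rel_zz.
  by ring.
have es : z * (t * v * x) = 0.
  transitivity (t * v * (x * z)); first by ring.
  rewrite rel_xz.
  transitivity (- al * t * x * (v * v)); first by ring.
  rewrite rel_vv.
  by ring.
by rewrite mul_of_coords etx etv euv evx evy evz es
  [z * t]mulrC rel_tz [z * u]mulrC rel_uz [z * v]mulrC [z * x]mulrC rel_xz [z * y]mulrC rel_yz rel_zz; mk_ring.
Qed.

(** The span of the fourteen monomials contains 1 and is stable under each variable by the
    multiplication table, so it contains every monomial. *)
Lemma of_coords_surj r : exists l, r = of_coords l.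
Proof.
have gen_mk i l : exists l', gen i * of_coords l = of_coords l'.
  case: i => [[|[|[|[|[|[|//]]]]]] lt_i]; rewrite (bool_irrelevance lt_i isT);
    [rewrite t_of_coords|rewrite u_of_coords|rewrite v_of_coords|rewrite x_of_coords|
     rewrite y_of_coords|rewrite z_of_coords];
    by eexists.
rewrite -[r]residueK [repr r]mpolyE raddf_sum.
elim/big_ind: _ => [|r1 r2 [l1 ->] [l2 ->]|m _].
- by exists [::]; rewrite /of_coords /= rmorph0; ring.
- by rewrite of_coordsD; eexists.
rewrite /= residueZ; suff [l ->] : exists l, residue alpha 'X_[m] = of_coords l.
  by rewrite of_coordsZ; eexists.
have mk1 : of_coords [:: 1] = 1 by rewrite /of_coords /= rmorph1 rmorph0; ring.
rewrite mpolyXE_id rmorph_prod /= -[\prod__ _]mulr1 -[X in _ * X]mk1.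
elim: (index_enum _) [:: 1] => [|i s IH] l.
  by exists l; rewrite big_nil mul1r.
rewrite big_cons -mulrA; have [l1 ->] := IH l.
rewrite rmorphXn /=; elim: (m i) l1 => [|n IHn] l1; first by exists l1; rewrite mul1r.
by have [l2 e2] := gen_mk i l1; rewrite exprSr -mulrA [X in _ * X]e2.
Qed.

Lemma socle_formD : {morph socle_form : r1 r2 / r1 + r2}.
Proof. exact: raddfD. Qed.

Lemma socle_form_of_coords l : socle_form (of_coords l) = l`_13.
Proof.
rewrite /of_coords !socle_formD -[X in socle_form X + _]mulr1 !socle_formZ.
rewrite socle_form_socle mulr1.
rewrite -(rmorph1 (residue alpha)) -mpolyX0 /t /u /v /x /y /z /gen.
rewrite -!rmorphM -!mpolyXD /= !socle_form_low ?mulr0 ?add0r //.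
all: by rewrite ?mdegD ?mdeg1 ?mdeg0.
Qed.

(** Linear independence: [socle_form] reads the last coordinate, and after multiplication by
    suitable monomials it isolates all the others. *)
Lemma of_coords_eq0 l : of_coords l = 0 -> forall i, (i < 14)%N -> l`_i = 0.
Proof.
move=> l0.
have F r : socle_form (r * of_coords l) = 0 by rewrite l0 mulr0 raddf0.
have := F 1; rewrite mul1r socle_form_of_coords => l13.
have := F t; rewrite t_of_coords socle_form_of_coords /= => l10.
have := F u; rewrite u_of_coords socle_form_of_coords /= => l12.
have := F v; rewrite v_of_coords socle_form_of_coords /= => l7.
have := F x; rewrite x_of_coords socle_form_of_coords /= l10 addr0 => l8.
have := F y; rewrite y_of_coords socle_form_of_coords /= => l11.
have := F z; rewrite z_of_coords socle_form_of_coords /= l7 mulr0 subr0 => l9.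
have := F (t * t); rewrite -mulrA !t_of_coords socle_form_of_coords /= => tt.
have := F (t * v); rewrite -mulrA v_of_coords t_of_coords socle_form_of_coords /= => l4.
have := F (x * t); rewrite -mulrA t_of_coords x_of_coords socle_form_of_coords /= => xt.
have := F (y * t); rewrite -mulrA t_of_coords y_of_coords socle_form_of_coords /= => l1.
have := F (v * y); rewrite -mulrA y_of_coords v_of_coords socle_form_of_coords /= => l5.
have := F (v * z); rewrite -mulrA z_of_coords v_of_coords socle_form_of_coords /= => l2.
have := F (u * v); rewrite -mulrA v_of_coords u_of_coords socle_form_of_coords /= => l6.
have := F (t * v * x); rewrite -!mulrA x_of_coords v_of_coords t_of_coords
  socle_form_of_coords /= => l0'.
have l3 : l`_3 = 0 by move: xt; rewrite l5 l6 mulr0 subr0 subr0 !addr0.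
by do 14![case=> //].
Qed.

Lemma of_coords_ext l1 l2 : (forall i, (i < 14)%N -> l1`_i = l2`_i) -> of_coords l1 = of_coords l2.
Proof. by move=> e; rewrite /of_coords !e. Qed.

Lemma of_coordsD3 l1 l2 l3 : of_coords l1 + of_coords l2 + of_coords l3 =
  of_coords [seq l1`_i + l2`_i + l3`_i | i <- iota 0 14].
Proof. by rewrite (of_coordsD l1 l2) of_coordsD. Qed.

Definition basis : seq R := [:: 1; t; u; v; x; y; z; t * x; t * v; u * v;
  v * x; v * y; v * z; t * v * x].

(** Dual to [basis] under [socle_form (r * s)], with entries of complementary degree. Correction
    terms cancel unwanted pairings: for instance x(vx) = tvx = x(tv), so [v * x - t * v] pairs to
    zero with [x]. *)
Definition dual_basis : seq R := [:: t * v * x; v * x - t * v; v * z;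
  t * x + al * (u * v); t * v; v * y; u * v; v; x - t; z + al * v; t; y; u; 1].

Lemma of_coords_sum l : of_coords l = \sum_(i < 14) kappa l`_i * basis`_i.
Proof. by rewrite !big_ord_recl big_ord0 /of_coords /=; ring. Qed.

Lemma of_coords_delta j : (j < 14)%N -> of_coords (mkseq (fun i => (i == j)%:R) 14) = basis`_j.
Proof.
move=> lt_j; have := @nth_mkseq _ (0 : k) (fun i => (i == j)%:R) 14%N.
move: (mkseq _ _) => l lE; rewrite of_coords_sum (bigD1 (Ordinal lt_j)) //= big1.
  by rewrite addr0 lE // eqxx rmorph1 mul1r.
move=> i; rewrite -val_eqE /= => /negPf ij.
by rewrite lE // ij rmorph0 mul0r.
Qed.

Lemma socle_form_dual l i : (i < 14)%N -> socle_form (dual_basis`_i * of_coords l) = l`_i.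
Proof.
have Nf r : socle_form (- r) = - socle_form r :> k by exact: raddfN.
have vZ c r : v * (kappa c * r) = kappa c * (v * r) by exact: mulrCA.
have uZ c r : u * (kappa c * r) = kappa c * (u * r) by exact: mulrCA.
case: i => [|[|[|[|[|[|[|[|[|[|[|[|[|[|//]]]]]]]]]]]]]] _ /=;
  rewrite ?(mulrDl, mulNr) -?mulrA ?(socle_formD, Nf) ?socle_formZ ?mul1r
  ?(x_of_coords, t_of_coords, y_of_coords, z_of_coords)
  ?(v_of_coords, u_of_coords, t_of_coords)
  ?(v_of_coords, u_of_coords, t_of_coords)
  !socle_form_of_coords /=; ring.
Qed.

Lemma socle_form_dual_basis (i j : 'I_14) :
  socle_form (dual_basis`_i * basis`_j) = (i == j)%:R :> k.
Proof.
rewrite -of_coords_delta // socle_form_dual // nth_mkseq //.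
Qed.

Lemma socle_form_span (r : R) :
  r = \sum_(i < 14) kappa (socle_form (dual_basis`_i * r)) * basis`_i.
Proof.
have [l ->] := of_coords_surj r; rewrite {1}of_coords_sum.
by apply: eq_bigr => i _; rewrite socle_form_dual.
Qed.

(** * Kernels of the matrices D_c and of the splicing matrix *)

Definition nat_mx m n (f : nat -> nat -> R) : 'M[R]_(m, n) := \matrix_(i, j) f i j.

(* The matrix (v y; c x z); the map d_0 is the case c = alpha. *)
Definition d_entry c (i j : nat) : R :=
  match i, j with
  | 0, 0 => v | 0, _ => y | _, 0 => (kappa c * x)%R | _, _ => z
  end%N.

(* The columns of d_entry 1 and (0, tv), which generate the kernel of d_0. *)
Definition e_entry (i j : nat) : R :=
  match i, j with
  | 0, 0 => v | 0, 1 => y | 0, _ => 0%R | _, 0 => x | _, 1 => z | _, _ => (t * v)%R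
  end%N.

Lemma cV2P (S : nzRingType) (w w' : 'cV[S]_2) : w ord0 0 = w' ord0 0 ->
  w (lift ord0 ord0) 0 = w' (lift ord0 ord0) 0 -> w = w'.
Proof.
move=> e0 e1; apply/colP => i; case: (unliftP ord0 i) => [j ->|-> //].
by rewrite (ord1 j).
Qed.

Lemma d_entry_mul c n (w : 'M_(2, n)) j :
  ((nat_mx 2 2 (d_entry c) *m w) ord0 j = v * w ord0 j + y * w (lift ord0 ord0) j) *
  ((nat_mx 2 2 (d_entry c) *m w) (lift ord0 ord0) j =
    kappa c * x * w ord0 j + z * w (lift ord0 ord0) j).
Proof. by rewrite !mxE !big_ord_recl !big_ord0 !mxE /= !addr0. Qed.

Lemma e_entry_mul n (w : 'M_(3, n)) j :
  ((nat_mx 2 3 e_entry *m w) ord0 j = v * w ord0 j + y * w (lift ord0 ord0) j) *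
  ((nat_mx 2 3 e_entry *m w) (lift ord0 ord0) j =
    x * w ord0 j + z * w (lift ord0 ord0) j + t * v * w (lift ord0 (lift ord0 ord0)) j).
Proof. by rewrite !mxE !big_ord_recl !big_ord0 !mxE /= !addr0 !mul0r addr0 addrA. Qed.

Lemma d_entry_comp c : nat_mx 2 2 (d_entry (alpha * c)) *m nat_mx 2 2 (d_entry c) = 0.
Proof.
apply/matrixP => i j; rewrite [RHS]mxE.
have E : al * x * v + z * x = 0 by rewrite [z * x]mulrC rel_xz; ring.
case: (unliftP ord0 i) => [i' ->|->]; rewrite ?(ord1 i') !d_entry_mul !mxE;
  case: (unliftP ord0 j) => [j' ->|->]; rewrite ?(ord1 j') /=.
- by rewrite -mulrA rel_xy mulr0 rel_zz addr0.
- by transitivity (kappa c * (al * x * v + z * x)); [rewrite rmorphM; ring|rewrite E mulr0].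
- by rewrite rel_yz [v * y]mulrC; ring.
- by rewrite rel_vv; transitivity (kappa c * (x * y)); [ring|rewrite rel_xy mulr0].
Qed.

Lemma e_entry_comp : nat_mx 2 2 (d_entry alpha) *m nat_mx 2 3 e_entry = 0.
Proof.
apply/matrixP => i j; rewrite [RHS]mxE.
have E : al * x * v + z * x = 0 by rewrite [z * x]mulrC rel_xz; ring.
have Y : y * (t * v) = 0.
  transitivity (v * (t * y)); first by ring.
  by rewrite rel_ty; transitivity (v * v * (x - t)); [ring|rewrite rel_vv mul0r].
have Z : z * (t * v) = 0.
  transitivity (v * (t * z)); first by ring.
  rewrite rel_tz; transitivity (v * v * (t - (1 + al) * x)); first by ring.
  by rewrite rel_vv mul0r.
case: (unliftP ord0 i) => [i' ->|->]; rewrite ?(ord1 i') !d_entry_mul !mxE;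
  case: (unliftP ord0 j) => [j' ->|->];
  try (case: (unliftP ord0 j') => [j'' ->|->]); rewrite ?(ord1 j'') /=.
- by rewrite mulr0 add0r Z.
- by rewrite -mulrA rel_xy mulr0 rel_zz addr0.
- exact: E.
- by rewrite mulr0 add0r Y.
- by rewrite rel_yz [v * y]mulrC; ring.
- by rewrite rel_vv [y * x]mulrC rel_xy addr0.
Qed.

Local Ltac coordinatewise :=
  move=> [|[|[|[|[|[|[|[|[|[|[|[|[|[|//]]]]]]]]]]]]]] _ /=.

(** The linear system for the kernel of D_c, solved in coordinates. The parameter matters through
    the coordinate of tv in the second entry, which becomes (1 - c) times the t-coordinate of [lb]:
    for c = 1 a linear coordinate would stay free. *)
Lemma d_entry_ker c la lb : alpha != 0 ->
  v * of_coords la + y * of_coords lb = 0 -> kappa c * x * of_coords la + z * of_coords lb = 0 ->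
  [/\ [/\ la`_0 = 0, lb`_0 = 0, lb`_5 = 0, la`_2 = 0 & la`_6 = 0],
      [/\ la`_1 = lb`_1, la`_4 = - lb`_1, la`_5 = lb`_6, lb`_2 = 0 & lb`_3 = 0] &
      [/\ (1 - c) * lb`_1 = 0, c * la`_3 = (1 + alpha) * lb`_1 + alpha * lb`_4,
        la`_7 = - lb`_11 & c * (la`_8 + la`_10) + lb`_9 = alpha * lb`_7]].
Proof.
move=> nz_al; rewrite -mulrA v_of_coords y_of_coords x_of_coords z_of_coords
  of_coordsZ !of_coordsD /= => /of_coords_eq0 h1 /of_coords_eq0 h2.
have := h1 3%N isT; have := h1 5%N isT; have := h1 7%N isT; have := h1 8%N isT.
have := h1 9%N isT; have := h1 10%N isT; have := h1 11%N isT; have := h1 12%N isT.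
have := h1 13%N isT; move=> /= e13 e12 e11 e10 e9 e8 e7 e5 e3.
have := h2 8%N isT; have := h2 9%N isT; have := h2 10%N isT.
have := h2 12%N isT; have := h2 13%N isT; move=> /= f13 f12 f10 f9 f8.
have b5 : lb`_5 = 0 by rewrite -[RHS]e7; ring.
have a6 : la`_6 = 0 by rewrite -[RHS]e12; ring.
have b3 : lb`_3 = 0 by rewrite -[RHS]f12; ring.
have b2 : lb`_2 = 0 by apply: (mulfI nz_al); rewrite mulr0 -[RHS]f9; ring.
have a4 : la`_4 = - lb`_1 by apply: subr0_eq; rewrite -[RHS]e10; ring.
split=> //; split=> //.
- by rewrite -[RHS]e3; ring.
- by rewrite -[RHS]e5; ring.
- by apply: (etrans _ e9); rewrite b5; ring.
- by apply: subr0_eq; rewrite -[RHS]e8; ring.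
- by apply: subr0_eq; rewrite -[RHS]e11 b3; ring.
- by apply: (etrans _ f8); rewrite a4; ring.
- by apply: subr0_eq; rewrite -[RHS]f10 a6; ring.
- by apply: subr0_eq; rewrite -[RHS]e13; ring.
- by apply: subr0_eq; rewrite -[RHS]f13; ring.
Qed.

(** The two exclusions act at different places: [alpha * c != 1] removes the spare linear coordinate
    from the kernel, while [c != 1] makes the coordinates of tv and vx in the image independent. *)
Lemma d_entry_exact c (w : 'cV[R]_2) : alpha != 0 -> c != 1 -> alpha * c != 1 ->
  nat_mx 2 2 (d_entry (alpha * c)) *m w = 0 -> exists w', w = nat_mx 2 2 (d_entry c) *m w'.
Proof.
move=> nz_al c1 ac1 w0.
have := congr1 (fun M : 'cV_2 => M ord0 0) w0.
have := congr1 (fun M : 'cV_2 => M (lift ord0 ord0) 0) w0.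
rewrite !d_entry_mul !mxE.
have [la ea] := of_coords_surj (w ord0 0); have [lb eb] := of_coords_surj (w (lift ord0 ord0) 0).
rewrite ea eb => E2 E1.
have [[a0 b0 b5 a2 a6] [a1 a4 a5 b2 b3] [b1 a3 a7 s]] := d_entry_ker nz_al E1 E2.
have {}b1 : lb`_1 = 0 by move/eqP: b1; rewrite mulf_eq0 subr_eq0 eq_sym (negPf ac1) => /eqP.
have {}a3 : c * la`_3 = lb`_4.
  by apply: (mulfI nz_al); rewrite mulrA a3 b1; ring.
have nz_c1 : c - 1 != 0 by rewrite subr_eq0.
(* Let [a4'] be the x-coordinate of the first entry of the preimage and [b1'] the t-coordinate of
   the second. The coordinate of vx in the first entry and that of tv in the second require
   [a4' + b1'] and [c * a4' + b1'] to have given values; subtracting the equations gives [a4']. All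
   other coordinates are solved one at a time, free ones being set to zero. *)
pose a4' := (lb`_8 - la`_10) / (c - 1).
pose b1' := la`_10 - a4'.
pose wa := of_coords [:: la`_3; la`_8 + b1'; la`_9 - (alpha - 1) * la`_7; alpha * la`_12;
  a4'; la`_11 - lb`_12; la`_12; la`_13].
pose wb := of_coords [:: la`_5; b1'; lb`_9 / alpha; lb`_12;
  - (lb`_10 + (1 + alpha) * b1') / alpha; la`_7; 0; 0; 0; lb`_13].
exists (\col_i if i == 0 then wa else wb).
apply: cV2P; rewrite d_entry_mul !mxE /= ?ea ?eb.
  by rewrite v_of_coords y_of_coords of_coordsD; apply: of_coords_ext; coordinatewise;
    rewrite ?(a0, b0, b5, a2, a6, a1, a4, a5, b2, b3, b1, a7) /b1'; ring.
rewrite -mulrA x_of_coords z_of_coords of_coordsZ of_coordsD; apply: of_coords_ext; coordinatewise.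
all: rewrite ?(a0, b0, b5, a2, a6, a1, a4, a5, b2, b3, b1) -?a3; try by ring.
- apply: (mulfI nz_al); rewrite -s /b1'; by field.
- by rewrite /b1' /a4'; field.
- by field.
- by field.
- by rewrite a7; ring.
Qed.

Lemma e_entry_exact (w : 'cV[R]_2) : alpha != 0 -> alpha != 1 ->
  nat_mx 2 2 (d_entry alpha) *m w = 0 -> exists w', w = nat_mx 2 3 e_entry *m w'.
Proof.
move=> nz_al ac1 w0.
have := congr1 (fun M : 'cV_2 => M ord0 0) w0.
have := congr1 (fun M : 'cV_2 => M (lift ord0 ord0) 0) w0.
rewrite !d_entry_mul !mxE.
have [la ea] := of_coords_surj (w ord0 0); have [lb eb] := of_coords_surj (w (lift ord0 ord0) 0).
rewrite ea eb => E2 E1.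
have [[a0 b0 b5 a2 a6] [a1 a4 a5 b2 b3] [b1 a3 a7 s]] := d_entry_ker nz_al E1 E2.
have {}b1 : lb`_1 = 0 by move/eqP: b1; rewrite mulf_eq0 subr_eq0 eq_sym (negPf ac1) => /eqP.
have {}a3 : la`_3 = lb`_4.
  by apply: (mulfI nz_al); rewrite a3 b1; ring.
pose wa := of_coords [:: la`_3; la`_8; la`_9 - (alpha - 1) * la`_7; alpha * la`_12;
  la`_10; la`_11 - lb`_12; la`_12; la`_13].
pose wb := of_coords [:: la`_5; 0; lb`_9 / alpha; lb`_12;
  - lb`_10 / alpha; la`_7; 0; 0; 0; lb`_13].
(* For c = 1 the two equations for tv and vx have the same left side, so their discrepancy must be
   supplied by the extra column (0, tv). *)
exists (\col_i if i == 0 then wa else if i == lift ord0 ord0 then wb else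
  kappa (lb`_8 - la`_10)).
apply: cV2P; rewrite e_entry_mul !mxE /= ?ea ?eb.
  by rewrite v_of_coords y_of_coords of_coordsD; apply: of_coords_ext; coordinatewise;
    rewrite ?(a0, b0, b5, a2, a6, a1, a4, a5, b2, b3, b1, a7); ring.
have -> : t * v * kappa (lb`_8 - la`_10) =
    of_coords [:: 0; 0; 0; 0; 0; 0; 0; 0; lb`_8 - la`_10].
  by rewrite /of_coords /= !rmorph0; ring.
rewrite x_of_coords z_of_coords of_coordsD3; apply: of_coords_ext; coordinatewise.
all: rewrite ?(a0, b0, b5, a2, a6, a1, a4, a5, b2, b3, b1) -?a3; try by ring.
- by apply: (mulfI nz_al); rewrite -s; field.
- by field.
- by field.
- by rewrite a7; ring.
Qed.

(** As [t * v * x] is dual to 1, the form reads the constant term. The kernel thus lies in the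
    maximal ideal times R^3, so the three columns are minimal generators. *)
Lemma e_entry_ker (w : 'cV[R]_3) : alpha != 0 -> nat_mx 2 3 e_entry *m w = 0 ->
  forall i, socle_form (t * v * x * w i 0) = 0.
Proof.
move=> nz_al w0.
have := congr1 (fun M : 'cV_2 => M ord0 0) w0.
have := congr1 (fun M : 'cV_2 => M (lift ord0 ord0) 0) w0.
rewrite !e_entry_mul !mxE.
set a := w ord0 0; set b := w (lift ord0 ord0) 0; set d := w (lift ord0 _) 0.
have [la ea] := of_coords_surj a; have [lb eb] := of_coords_surj b;
  have [ld ed] := of_coords_surj d.
rewrite ea eb ed -[t * v * _]mulrA !v_of_coords x_of_coords y_of_coords z_of_coords
  t_of_coords of_coordsD3 of_coordsD /= => /of_coords_eq0 h2 /of_coords_eq0 h1.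
have /= a0 := h1 3%N isT; have /= b0 := h1 5%N isT; have /= e10 := h1 10%N isT.
have /= f8 := h2 8%N isT.
have C l : l`_0 = 0 -> socle_form (t * v * x * of_coords l) = 0.
  by move=> l0; rewrite -!mulrA x_of_coords v_of_coords t_of_coords socle_form_of_coords.
move=> i; case: (unliftP ord0 i) => [j ->|->]; last first.
  by rewrite -/a ea C // -[RHS]a0; ring.
case: (unliftP ord0 j) => [j' ->|->]; rewrite ?(ord1 j') -/b -/d ?eb ?ed C //.
  have -> : ld`_0 = la`_4 + lb`_1 + (ld`_0 - 0 + 0) - (la`_4 + lb`_1) by ring.
  by rewrite f8 e10 subrr.
by rewrite -[RHS]b0; ring.
Qed.

(** * Powers of the maximal ideal and units *)

Definition rcoord (i : nat) (r : R) : k := socle_form (dual_basis`_i * r).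

Lemma rcoord_of_coords l i : (i < 14)%N -> rcoord i (of_coords l) = l`_i.
Proof. exact: socle_form_dual. Qed.

Lemma of_coords_rcoord r : r = of_coords (mkseq (rcoord^~ r) 14).
Proof.
have [l ->] := of_coords_surj r; apply: of_coords_ext => i lt_i.
by rewrite nth_mkseq // rcoord_of_coords.
Qed.

Lemma rcoordD i : {morph rcoord i : r s / r + s}.
Proof. by move=> r s; rewrite /rcoord mulrDr socle_formD. Qed.

Lemma rcoordZ i c r : rcoord i (kappa c * r) = c * rcoord i r.
Proof. by rewrite /rcoord mulrCA socle_formZ. Qed.

(* The number of basis elements of degree less than j. *)
Definition layer (j : nat) : nat :=
  match j with 0 => 0 | 1 => 1 | 2 => 7 | 3 => 13 | _ => 14 end.

(* The j-th power of the maximal ideal. *)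
Definition mpow (j : nat) (r : R) := forall i, (i < layer j)%N -> rcoord i r = 0.

Lemma mpowD j r s : mpow j r -> mpow j s -> mpow j (r + s).
Proof. by move=> fr fs i lt_i; rewrite rcoordD fr // fs // addr0. Qed.

Lemma mpowZ j c r : mpow j r -> mpow j (kappa c * r).
Proof. by move=> fr i lt_i; rewrite rcoordZ fr // mulr0. Qed.

Lemma layer_le j : (layer j <= 14)%N.
Proof. by case: j => [|[|[|[|j]]]]. Qed.

Lemma mpow_of_coords j l : mpow j (of_coords l) <-> (forall i, (i < layer j)%N -> l`_i = 0).
Proof.
split=> h i lt_i; have := h i lt_i; rewrite rcoord_of_coords //;
  exact: leq_trans lt_i (layer_le j).
Qed.

Lemma mpow_gen j r : mpow j r -> [/\ mpow j.+1 (t * r), mpow j.+1 (u * r),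
  mpow j.+1 (v * r) & [/\ mpow j.+1 (x * r), mpow j.+1 (y * r) & mpow j.+1 (z * r)]].
Proof.
have [l ->] := of_coords_surj r; move=> /mpow_of_coords fl.
rewrite t_of_coords u_of_coords v_of_coords x_of_coords y_of_coords z_of_coords.
split; try split; apply/mpow_of_coords; case: j fl => [|[|[|[|j]]]] /= fl.
all: case=> [|[|[|[|[|[|[|[|[|[|[|[|[|[|//]]]]]]]]]]]]]] //= _;
  rewrite ?fl // ?(mulr0, addr0, subr0, oppr0) //.
Qed.

Lemma mpow0 j : mpow j 0.
Proof. by move=> i _; rewrite /rcoord mulr0 raddf0. Qed.

Lemma mpowS j r : mpow j.+1 r -> mpow j r.
Proof.
move=> f i lt_i; apply: f; apply: leq_trans lt_i _.
by case: j => [|[|[|[|j]]]].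
Qed.

(** One variable is pulled out of every nonconstant term, which reduces multiplication by an element
    of the maximal ideal to [mpow_gen]. *)
Lemma of_coords_decomp_mul l r : of_coords l * r = kappa l`_0 * r +
  (t * (kappa l`_1 * r + kappa l`_7 * (x * r) + kappa l`_8 * (v * r) + kappa l`_13 * (v * (x * r))) +
   u * (kappa l`_2 * r + kappa l`_9 * (v * r)) +
   v * (kappa l`_3 * r + kappa l`_10 * (x * r) + kappa l`_11 * (y * r) + kappa l`_12 * (z * r)) +
   x * (kappa l`_4 * r) + y * (kappa l`_5 * r) + z * (kappa l`_6 * r)).
Proof. by rewrite /of_coords; ring. Qed.

Lemma mpow_mul j a r : mpow 1 a -> mpow j r -> mpow j.+1 (a * r).
Proof.
have [l ->] := of_coords_surj a => /mpow_of_coords l0 fr.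
rewrite of_coords_decomp_mul l0 // rmorph0 mul0r add0r.
have [T U V] : [/\ forall s, mpow j s -> mpow j.+1 (t * s),
    forall s, mpow j s -> mpow j.+1 (u * s) & forall s, mpow j s -> mpow j.+1 (v * s)].
  by split=> s /mpow_gen[].
have [X Y Z] : [/\ forall s, mpow j s -> mpow j.+1 (x * s),
    forall s, mpow j s -> mpow j.+1 (y * s) & forall s, mpow j s -> mpow j.+1 (z * s)].
  by split=> s /mpow_gen[_ _ _ []].
have fZ c s : mpow j s -> mpow j (kappa c * s) by exact: mpowZ.
have fx := mpowS (X _ fr); have fv := mpowS (V _ fr); have fy := mpowS (Y _ fr).
have fz := mpowS (Z _ fr); have fvx := mpowS (V _ fx).
exact: (mpowD (mpowD (mpowD (mpowD (mpowD
  (T _ (mpowD (mpowD (mpowD (fZ _ _ fr) (fZ _ _ fx)) (fZ _ _ fv)) (fZ _ _ fvx)))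
  (U _ (mpowD (fZ _ _ fr) (fZ _ _ fv))))
  (V _ (mpowD (mpowD (mpowD (fZ _ _ fr) (fZ _ _ fx)) (fZ _ _ fy)) (fZ _ _ fz))))
  (X _ (fZ _ _ fr))) (Y _ (fZ _ _ fr))) (Z _ (fZ _ _ fr))).
Qed.

(** [rcoord 0] is the residue map to [k]: the nonconstant part of [a] contributes only to the
    maximal ideal. *)
Lemma rcoord0M a b : rcoord 0 (a * b) = rcoord 0 a * rcoord 0 b.
Proof.
have [l ->] := of_coords_surj a; have [l' ->] := of_coords_surj b.
have E : of_coords l - kappa l`_0 = of_coords (0 :: behead l).
  by rewrite /of_coords /= rmorph0 !nth_behead; ring.
have -> : of_coords l * of_coords l' =
    kappa l`_0 * of_coords l' + of_coords (0 :: behead l) * of_coords l'.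
  by rewrite -E; ring.
rewrite rcoordD rcoordZ !rcoord_of_coords // [X in _ + X](_ : _ = 0) ?addr0 //.
apply: (@mpow_mul 0%N) => //; apply/mpow_of_coords; by case.
Qed.

Lemma mpow1_rcoord0 a : rcoord 0 a = 0 -> mpow 1 a.
Proof. by move=> a0 []. Qed.

Lemma mpow4 r : mpow 4 r -> r = 0.
Proof.
move=> f; rewrite [r]of_coords_rcoord (_ : of_coords _ = of_coords (nseq 14 0)).
  by rewrite /of_coords /= rmorph0; ring.
by apply: of_coords_ext => i lt_i; rewrite nth_mkseq // nth_nseq if_same f.
Qed.

(** After scaling, r is 1 - n with n in the maximal ideal, whose fourth power is zero; the geometric
    series stops at n^3. *)
Lemma rcoord0_unit r : rcoord 0 r != 0 -> exists r', r' * r = 1.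
Proof.
move=> r0; pose c := (rcoord 0 r)^-1; pose n := 1 - kappa c * r.
have one0 : rcoord 0 1 = 1.
  by rewrite -socle_form_socle /rcoord mulr1.
have fn : mpow 1 n.
  apply: mpow1_rcoord0; rewrite /n -[- _]mulN1r -(rmorph1 kappa) -rmorphN rcoordD.
  by rewrite rmorph1 one0 rcoordZ rcoordZ mulN1r mulVf ?subrr.
have n4 : n * (n * (n * n)) = 0 by exact: (mpow4 (mpow_mul fn (mpow_mul fn (mpow_mul fn fn)))).
exists (kappa c * (1 + n + n * n + n * (n * n))).
have -> : kappa c * (1 + n + n * n + n * (n * n)) * r =
   (1 + n + n * n + n * (n * n)) * (1 - n) by rewrite /n; ring.
by transitivity (1 - n * (n * (n * n))); [ring | rewrite n4 subr0].
Qed.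

(** * Minimal covers *)

Let lamD := socle_formD.
Let lamZ := socle_formZ.
Definition basis_ord (i : 'I_14) : R := basis`_i.
Definition dual_ord (i : 'I_14) : R := dual_basis`_i.

Let ldual i j : socle_form (dual_ord i * basis_ord j) = (i == j)%:R.
Proof. exact: socle_form_dual_basis. Qed.
Let lspan r : r = \sum_i kappa (socle_form (dual_ord i * r)) * basis_ord i.
Proof. exact: socle_form_span. Qed.

Local Notation enc := (@encode k R socle_form 14 dual_ord _).
Local Notation dec := (@decode k R kappa 14 basis_ord _).

Definition kmx p q (A : 'M[R]_(q, p)) : 'Hom('M[k]_(p, 14), 'M[k]_(q, 14)) :=
  @mxhom k R kappa socle_form 14 basis_ord dual_ord p q A.

Lemma encE p (w : 'cV[R]_p) i j : enc w i j = rcoord j (w i 0).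
Proof. by rewrite mxE. Qed.

Lemma encK p : cancel (enc : 'cV[R]_p -> _) dec.
Proof. exact: (encodeK lspan). Qed.

Lemma decK p : cancel (dec : 'M_(p, 14) -> _) enc.
Proof. exact: (decodeK lamD lamZ ldual). Qed.

Lemma kmxE p q (A : 'M[R]_(q, p)) w : kmx A (enc w) = enc (A *m w).
Proof. exact: (mxhomE lamD lamZ ldual lspan). Qed.

Lemma mem_lker_kmx p q (A : 'M[R]_(q, p)) w : (enc w \in lker (kmx A)) = (A *m w == 0).
Proof. exact: (mem_lker_mxhom lamD lamZ ldual lspan). Qed.

Lemma kmx_rank_nullity p q (A : 'M[R]_(q, p)) :
  (\dim (lker (kmx A)) + \dim (limg (kmx A)) = p * 14)%N.
Proof. exact: mxhom_rank_nullity. Qed.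

Lemma exact_limg p q r (A : 'M[R]_(r, q)) (B : 'M[R]_(q, p)) :
  exact_mx A B -> lker (kmx A) = limg (kmx B).
Proof.
move=> [AB0 ex]; apply/vspaceP => M; rewrite -[M]decK mem_lker_kmx.
apply/eqP/memv_imgP => [/ex[w' ->]|[M' _]].
  by exists (enc w'); rewrite ?memvf // kmxE.
rewrite -[M']decK kmxE => /(can_inj (@encK _)) ->.
by rewrite mulmxA AB0 mul0mx.
Qed.

Definition minimal_mx p q (A : 'M[R]_(q, p)) := forall i j, rcoord 0 (A i j) = 0.

Lemma minimal_mulmx p q (A : 'M[R]_(q, p)) (w : 'cV_p) i : minimal_mx A ->
  (forall j, rcoord 0 (w j 0) = 0) -> mpow 2 ((A *m w) i 0).
Proof.
move=> mA w0; rewrite mxE; apply: (big_ind (mpow 2)); first exact: mpow0.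
  exact: mpowD.
by move=> j _; apply: mpow_mul; apply: mpow1_rcoord0.
Qed.

(* The image is spanned by the images of the p unit vectors together with a part
   of m^2 R^q, which has dimension 7q. *)
Lemma minimal_limg p q (A : 'M[R]_(q, p)) : minimal_mx A ->
  (\dim (limg (kmx A)) <= p + 7 * q)%N.
Proof.
move=> mA.
pose lo : 'Hom('M[k]_(q, 14), 'M[k]_(q, 7)) :=
  linfun (mxsub id (fun j : 'I_7 => inord j : 'I_14)).
pose hi : 'Hom('M[k]_(q, 14), 'M[k]_(q, 7)) :=
  linfun (mxsub id (fun j : 'I_7 => inord (7 + j) : 'I_14)).
pose c0 : 'Hom('M[k]_(p, 14), 'cV[k]_p) := linfun (@col k p 14 0).
have loE M : lo M = \matrix_(i, j) M i (inord j) by exact: lfunE.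
have hiE M : hi M = \matrix_(i, j) M i (inord (7 + j)) by exact: lfunE.
have c0E M : c0 M = col 0 M by exact: lfunE.
rewrite -(limg_ker_dim lo) addnC leq_add //.
  rewrite -limg_comp.
  have le_ker : (lker c0 <= lker (lo \o kmx A))%VS.
    apply/subvP => M; rewrite !memv_ker -[M]decK comp_lfunE kmxE loE c0E.
    move: (dec M) => w /eqP/colP w0; apply/eqP/matrixP => i j.
    rewrite [RHS]mxE [LHS]mxE encE; apply: (minimal_mulmx i mA);
      last by rewrite inordK ?ltn_ord // ltnS (leq_trans (ltnW (ltn_ord j))).
    by move=> l; have := w0 l; rewrite [RHS]mxE [LHS]mxE encE.
  have := limg_ker_dim c0 fullv; have := limg_ker_dim (lo \o kmx A) fullv.
  rewrite !capfv !dimvf => e1 e2; have := dimvS le_ker.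
  have : (\dim (limg c0) <= p)%N by apply: leq_trans (dimvS (subvf _)) _; rewrite dimvf dim_matrix mulr1.
  move=> a b; apply: leq_trans a; rewrite -(leq_add2l (\dim (lker c0))) e2 -e1.
  by rewrite leq_add2r.
rewrite (leq_trans (dimvS (capvSr _ _))) // (leq_trans (@dim_le_inj _ _ _ hi _ _)) //.
  move=> M; rewrite memv_ker loE hiE => /eqP/matrixP l0 /matrixP r0.
  apply/matrixP => i j; rewrite mxE; have [lt_j|le_j] := ltnP j 7.
    by have := l0 i (Ordinal lt_j); rewrite !mxE /= inord_val.
  have lt_j : (j - 7 < 7)%N by rewrite ltn_subLR // ltn_ord.
  by have := r0 i (Ordinal lt_j); rewrite !mxE /= subnKC // inord_val.
by rewrite dim_matrix mulrC.
Qed.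

(** A [k]-basis of the kernel generates it over [R]. The cover is wasteful, but it shows that a
    least number of columns exists. *)
Lemma finite_cover p q (A : 'M[R]_(q, p)) :
  exists n (B : 'M[R]_(p, n)), exact_mx A B.
Proof.
pose K := lker (kmx A); pose B := \matrix_(i, j) dec (vbasis K)`_j i 0 : 'M[R]_(p, \dim K).
have colB j : B *m delta_mx j 0 = dec (vbasis K)`_j.
  by rewrite -colE; apply/colP => i; rewrite !mxE.
exists (\dim K), B; split.
  have AB j : A *m (B *m delta_mx j (0 : 'I_1)) = 0.
    rewrite colB; apply/eqP; rewrite -mem_lker_kmx decK vbasis_mem //.
    by rewrite mem_nth ?size_tuple.
  apply/matrixP => i j; have /colP/(_ i) := AB j.
  by rewrite mulmxA -colE !mxE.
move=> w /eqP; rewrite -mem_lker_kmx => /coord_vbasis e.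
exists (\col_j kappa (coord (vbasis K) j (enc w))).
rewrite -[LHS]encK [in LHS]e (big_morph _ (@decode_is_additive _ _ kappa _ basis_ord p)
  (decode0 _ _ _)); apply/colP => i; rewrite summxE mxE.
by apply: eq_bigr => j _; rewrite decodeZ [LHS]mxE !mxE mulrC.
Qed.

(** A relation among the columns with a unit coefficient at [j] expresses column [j] through the
    others. *)
Lemma remove_column p n (B : 'M[R]_(p, n.+1)) (w : 'cV_n.+1) j :
  B *m w = 0 -> rcoord 0 (w j 0) != 0 ->
  forall w1 : 'cV_n.+1, exists w2 : 'cV_n, B *m w1 = col' j B *m w2.
Proof.
move=> Bw /rcoord0_unit[r rw] w1; pose w3 := w1 - (w1 j 0 * r) *: w.
have w3j : w3 j 0 = 0 by rewrite !mxE -mulrA rw mulr1 subrr.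
exists (row' j w3); have -> : B *m w1 = B *m w3.
  by rewrite mulmxBr -scalemxAr Bw scaler0 subr0.
apply/colP => i; rewrite !mxE (bigD1_ord j) //= w3j mulr0 add0r.
by apply: eq_bigr => l _; rewrite !mxE.
Qed.

(** Instead of Nakayama's lemma, the number of columns is taken least possible: a relation with a
    unit coefficient would allow one to be dropped. *)
Lemma minimal_cover p q (A : 'M[R]_(q, p)) :
  exists n (B : 'M[R]_(p, n)), exact_mx A B /\
    forall w : 'cV_n, B *m w = 0 -> forall j, rcoord 0 (w j 0) = 0.
Proof.
pose P n := `[< exists B : 'M[R]_(p, n), exact_mx A B >].
have exP : exists n, P n by have [n B] := finite_cover A; exists n; apply/asboolP.
have [n /asboolP[B [AB exB]] min_n] := ex_minnP exP.
exists n, B; split=> // w Bw j; apply/eqP; apply: contraT => wj.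
case: n B AB exB min_n w Bw j wj => [|n] B AB exB min_n w Bw j wj; first by case: j {wj}.
suff /min_n : P n by rewrite ltnn.
apply/asboolP; exists (col' j B); split.
  by apply/matrixP => i l; have /matrixP/(_ i (lift j l)) := AB; rewrite !mxE => E;
     rewrite -[RHS]E; apply: eq_bigr => a _; rewrite !mxE.
move=> w1 /exB[w2 ->]; exact: remove_column Bw wj w2.
Qed.

(* 9p <= dim im B <= n + 7p gives 2p <= n, whence
   dim ker B >= 14n - (n + 7p) >= 9n. *)
Lemma cover_step p q (A : 'M[R]_(q, p)) : (0 < p)%N ->
  (forall w : 'cV_p, A *m w = 0 -> forall j, rcoord 0 (w j 0) = 0) ->
  (9 * p <= \dim (lker (kmx A)))%N ->
  exists n (B : 'M[R]_(p, n)), [/\ (p < n)%N, exact_mx A B, minimal_mx B,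
    forall w : 'cV_n, B *m w = 0 -> forall j, rcoord 0 (w j 0) = 0 &
    (9 * n <= \dim (lker (kmx B)))%N].
Proof.
move=> p_gt0 kerA dimA; have [n [B [exB kerB]]] := minimal_cover A.
have mB : minimal_mx B.
  move=> i j; have := kerA (B *m delta_mx j 0); rewrite mulmxA (proj1 exB) mul0mx.
  by move=> /(_ erefl i); rewrite -colE mxE.
exists n, B; move: (minimal_limg mB) (kmx_rank_nullity B); rewrite -(exact_limg exB).
by move=> ? ?; split=> //; lia.
Qed.

Section Sequence.

Hypothesis nz_al : alpha != 0.
Hypothesis al1 : alpha != 1.

Lemma exact_d_entry c : c != 1 -> alpha * c != 1 ->
  exact_mx (nat_mx 2 2 (d_entry (alpha * c))) (nat_mx 2 2 (d_entry c)).
Proof.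
move=> c1 ac1; split; first exact: d_entry_comp.
by move=> w; apply: d_entry_exact.
Qed.

Lemma exact_e_entry : exact_mx (nat_mx 2 2 (d_entry alpha)) (nat_mx 2 3 e_entry).
Proof. by split; [exact: e_entry_comp | move=> w; apply: e_entry_exact]. Qed.

Lemma exact_mx_tr p q r (A : 'M[R]_(r, q)) (B : 'M[R]_(q, p)) :
  exact_mx A B -> exact_mx B^T A^T.
Proof.
move=> [AB0 exAB]; split; first by rewrite -trmx_mul AB0 trmx0.
exact: (dual_exact socle_formD socle_formZ
  socle_form_dual_basis socle_form_span exAB).
Qed.

Lemma dim_ker_d_entry : (\dim (lker (kmx (nat_mx 2 2 (d_entry alpha)))) <= 14)%N.
Proof.
(* The seven coordinates of each entry that remain free in the solution of [d_entry_ker]; they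
   determine the other fourteen. *)
pose sa := [:: 7; 8; 9; 10; 11; 12; 13]%N; pose sb := [:: 4; 6; 7; 8; 10; 12; 13]%N.
pose s := [seq (ord0, inord j) | j <- sa] ++ [seq (lift ord0 ord0, inord j) | j <- sb]
  : seq ('I_2 * 'I_14).
apply: leq_trans (@dim_le_inj _ _ _ (linfun (entries s)) _ _) _; last first.
  by rewrite dim_matrix.
move=> M; rewrite -[M]decK mem_lker_kmx lfunE /=; move: (decode _ _ M) => w.
move=> /eqP w0 h0; have {h0} e0 := @entries_eq0 k 2 14 s _ h0.
have := congr1 (fun N : 'cV_2 => N ord0 0) w0.
have := congr1 (fun N : 'cV_2 => N (lift ord0 ord0) 0) w0.
rewrite !d_entry_mul !mxE.
have [la ea] := of_coords_surj (w ord0 0); have [lb eb] := of_coords_surj (w (lift ord0 ord0) 0).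
have A j : j \in sa -> la`_j = 0.
  move=> Sj; have /allP/(_ _ Sj) lt_j : all (fun j => j < 14)%N sa by [].
  have /= := e0 (ord0, inord j); rewrite mem_cat map_f // encE ea inordK //.
  by rewrite rcoord_of_coords // => ->.
have B j : j \in sb -> lb`_j = 0.
  move=> Sj; have /allP/(_ _ Sj) lt_j : all (fun j => j < 14)%N sb by [].
  have /= := e0 (lift ord0 ord0, inord j).
  rewrite mem_cat (map_f _ Sj) orbT encE eb inordK //.
  by rewrite rcoord_of_coords // => ->.
rewrite ea eb => E2 E1.
have [[a0 b0 b5 a2 a6] [a1 a4 a5 b2 b3] [b1 a3 a7 sq]] := d_entry_ker nz_al E1 E2.
have {}b1 : lb`_1 = 0 by move/eqP: b1; rewrite mulf_eq0 subr_eq0 eq_sym (negPf al1) => /eqP.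
have mk0 l : (forall i, (i < 14)%N -> l`_i = 0) -> of_coords l = 0.
  by move=> l0; rewrite /of_coords !l0 // rmorph0; ring.
suff -> : w = 0 by apply/matrixP => i j; rewrite encE !mxE /rcoord mulr0 raddf0.
apply: cV2P; rewrite [RHS]mxE ?ea ?eb mk0 //.
  case=> [|[|[|[|[|[|[|i]]]]]]] lt_i //; first by rewrite a1.
  - by apply: (mulfI nz_al); rewrite a3 b1 (B 4%N) // !mulr0 addr0.
  - by rewrite a4 b1 oppr0.
  - by rewrite a5 (B 6%N).
  - by apply: A; move: i lt_i => [|[|[|[|[|[|[|[|i]]]]]]]].
case=> [|[|[|[|[|[|[|i]]]]]]] lt_i //; try by rewrite B.
move: i lt_i => [|[|[|[|[|[|[|i]]]]]]] // _; try by rewrite B.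
  by move: sq; rewrite (A 8%N) // (A 10%N) // (B 7%N) // addr0 !mulr0 add0r.
by apply: oppr_inj; rewrite -a7 A // oppr0.
Qed.

(** R^3 has dimension 42 and the image, being the kernel of d_0, at most 14, so the kernel has
    dimension at least 28. The bound 27 is nine times three. The factor nine is forced: eight would
    only give p <= n in the inductive step, and ten times three exceeds 28. *)
Lemma dim_ker_e_entry : (27 <= \dim (lker (kmx (nat_mx 2 3 e_entry))))%N.
Proof.
have := kmx_rank_nullity (nat_mx 2 3 e_entry); have := dim_ker_d_entry.
by rewrite (exact_limg exact_e_entry); lia.
Qed.

Lemma rcoord0_gens : [/\ rcoord 0 v = 0, rcoord 0 x = 0,
  rcoord 0 y = 0 & rcoord 0 z = 0].
Proof.
have fil01 : mpow 0 (1 : R) by [].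
have [_ _ + [+ + +]] := mpow_gen fil01; rewrite !mulr1 => fv fx fy fz.
by split; [apply: fv|apply: fx|apply: fy|apply: fz].
Qed.

Lemma e_entry_minimal : minimal_mx (nat_mx 2 3 e_entry).
Proof.
have [v0 x0 y0 z0] := rcoord0_gens.
move=> [[|[|//]] hi] [[|[|[|//]]] hj]; rewrite mxE //=.
  by rewrite /rcoord mulr0 raddf0.
by rewrite rcoord0M v0 mulr0.
Qed.

Definition mx_fun p q (A : 'M[R]_(p, q)) (i j : nat) : R :=
  if insub i is Some i' then if insub j is Some j' then A i' j' else 0 else 0.

Lemma mx_funK p q (A : 'M[R]_(p, q)) : nat_mx p q (mx_fun A) = A.
Proof. by apply/matrixP => i j; rewrite mxE /mx_fun !valK. Qed.

(** The invariant of the recursion that builds the resolution. Storing entries as functions on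
    natural numbers lets consecutive matrices match through plain equations between numbers. *)
Record cover_state := CoverState {
  rows : nat; cols : nat; ent : nat -> nat -> R;
  cols_gt0 : (0 < cols)%N;
  ker_minimal : forall w, nat_mx rows cols ent *m w = 0 ->
    forall j, rcoord 0 (w j (0 : 'I_1)) = 0;
  dim_ker : (9 * cols <= \dim (lker (kmx (nat_mx rows cols ent))))%N }.

Lemma cover_next (st : cover_state) : exists st' : cover_state,
  [/\ rows st' = cols st, (cols st < cols st')%N,
      minimal_mx (nat_mx (rows st') (cols st') (ent st')) &
      exact_mx (nat_mx (rows st) (cols st) (ent st)) (nat_mx (cols st) (cols st') (ent st'))].
Proof.
case: st => p q f q_gt0 kerf dimf /=.
have [n [B [lt_qn exB mB kerB dimB]]] := cover_step q_gt0 kerf dimf.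
have n_gt0 : (0 < n)%N by apply: leq_ltn_trans lt_qn.
move: exB mB kerB dimB; rewrite -(mx_funK B) => exB mB kerB dimB.
by exists (CoverState n_gt0 kerB dimB).
Qed.

Lemma minimal_resolution :
  exists (b : nat -> nat) (g : nat -> nat -> nat -> R),
  [/\ b 0%N = 2%N, g 0%N = e_entry, forall n, (b n < b n.+1)%N,
    forall n, minimal_mx (nat_mx (b n) (b n.+1) (g n)) &
    b 1%N = 3%N /\ forall n,
      exact_mx (nat_mx (b n) (b n.+1) (g n)) (nat_mx (b n.+1) (b n.+2) (g n.+1))].
Proof.
have kerE w : nat_mx 2 3 e_entry *m w = 0 -> forall j, rcoord 0 (w j (0 : 'I_1)) = 0.
  by move=> w0 j; apply: e_entry_ker.
pose st0 := CoverState (isT : 0 < 3)%N kerE dim_ker_e_entry.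
pose next st := projT1 (cid (cover_next st)).
have nextP st := projT2 (cid (cover_next st)).
pose st n := iter n next st0.
(* The index is shifted by one: [b 0] is the number of rows of the first matrix, and [b n.+1] the
   number of columns of matrix [n]. *)
pose b n := if n is m.+1 then cols (st m) else 2%N.
have rowsE n : rows (st n) = b n by case: n => [|n] //; have [] := nextP (st n).
exists b, (fun n => ent (st n)); split=> //.
- by case=> [|n] //=; have [] := nextP (st n).
- case=> [|n]; first exact: e_entry_minimal.
  by rewrite -(rowsE n.+1); have [_ _ m _] := nextP (st n); exact: m.
by split=> // n; rewrite -(rowsE n); have [_ _ _ e] := nextP (st n); exact: e.
Qed.

End Sequence.

(** * The module N *)

Local Notation N := (N_mod alpha).

(* The coefficient of x in the image of r in N = k[x]/(x^2), where
   v, y and z become x. *)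
Definition theta (r : R) : k := rcoord 3 r + rcoord 4 r + rcoord 5 r + rcoord 6 r.

Lemma theta_of_coords l : theta (of_coords l) = l`_3 + l`_4 + l`_5 + l`_6.
Proof. by rewrite /theta !rcoord_of_coords. Qed.

Lemma thetaD : {morph theta : a b / a + b}.
Proof. by move=> a b; rewrite /theta !rcoordD; ring. Qed.

Lemma thetaZ c r : theta (kappa c * r) = c * theta r.
Proof. by rewrite /theta !rcoordZ; ring. Qed.

Lemma theta_mpow2 r : mpow 2 r -> theta r = 0.
Proof. by move=> f; rewrite /theta !f // !addr0. Qed.

Lemma rcoord0_kappa c : rcoord 0 (kappa c) = c.
Proof. by rewrite -[kappa c]mulr1 rcoordZ /rcoord mulr1 socle_form_socle mulr1. Qed.

Lemma theta_kappa c : theta (kappa c) = 0.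
Proof.
have -> : kappa c = of_coords [:: c] by rewrite /of_coords /= !rmorph0; ring.
by rewrite theta_of_coords /= !addr0.
Qed.

(** The Leibniz rule, which says that [rcoord 0] and [theta] are the two components of a ring map
    from [R] to the dual numbers. *)
Lemma thetaM a b : theta (a * b) = rcoord 0 a * theta b + theta a * rcoord 0 b.
Proof.
have split_ r : exists2 r', rcoord 0 r' = 0 & r = kappa (rcoord 0 r) + r'.
  exists (r + kappa (- rcoord 0 r)); last by rewrite rmorphN; ring.
  by rewrite rcoordD rcoord0_kappa subrr.
have [a' a'0 ea] := split_ a; have [b' b'0 eb] := split_ b.
have -> : a * b = kappa (rcoord 0 a) * b + (kappa (rcoord 0 b) * a' + a' * b').
  by rewrite [in LHS]ea [in LHS]eb [X in _ * X + _]eb; ring.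
rewrite !thetaD !thetaZ (theta_mpow2 (mpow_mul _ _)) ?addr0; try exact: mpow1_rcoord0.
by rewrite [in RHS]ea !thetaD !theta_kappa rcoordD rcoord0_kappa a'0; ring.
Qed.

Lemma gens_theta : [/\ theta t = 0, theta u = 0, theta v = 1 & theta x = 1] /\
  [/\ theta y = 1, theta z = 1, rcoord 0 t = 0 & rcoord 0 u = 0].
Proof.
have mk1 : of_coords [:: 1] = 1 by rewrite /of_coords /= rmorph1 !rmorph0; ring.
by rewrite -[t]mulr1 -[u]mulr1 -[v]mulr1 -[x]mulr1 -[y]mulr1 -[z]mulr1 -mk1
  t_of_coords u_of_coords v_of_coords x_of_coords y_of_coords z_of_coords
  !theta_of_coords !rcoord_of_coords //= !(addr0, add0r).
Qed.

Definition one_N : N := qproj _ (1 : R^o).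

Lemma N_gen (n : N) : exists r, n = r *: one_N.
Proof.
exists (qrepr n); rewrite /one_N -linearZ /= -[LHS]qreprK; congr qproj.
exact: esym (mulr1 _).
Qed.

Lemma N_kill r s : r \in [:: t; u; v - x; y - x; z - x] -> (r * s) *: one_N = 0.
Proof.
move=> rJ; rewrite mulrC -scalerA.
suff -> : r *: one_N = 0 by rewrite scaler0.
rewrite /one_N -linearZ /=; apply: qproj_eq0.
by rewrite [_ *: _]mulr1.
Qed.

(** Identifies N with the dual numbers. Both components vanish on the generators of the ideal, hence
    on their multiples; conversely, modulo the ideal all variables reduce to 0 or x, and terms of
    degree at least 2 die. *)
Lemma N_eq0 r : r *: one_N = 0 <-> rcoord 0 r = 0 /\ theta r = 0.
Proof.
split.
  have -> : r *: one_N = qproj _ (r : R^o).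
    by rewrite /one_N -linearZ /=; congr qproj; apply: mulr1.
  rewrite -(linear0 (qproj _)) => /qproj_inj; rewrite subr0 => /asboolP[s [Js ->]].
  have [[t0 u0 v1 x1] [y1 z1 ct cu]] := gens_theta.
  have [cv cx cy cz] := rcoord0_gens.
  have J w : w \in [:: t; u; v - x; y - x; z - x] -> rcoord 0 w = 0 /\ theta w = 0.
    have B a b : a - b = a + kappa (-1) * b by rewrite rmorphN1 mulN1r.
    by rewrite !inE; do 4?[case/orP]; move/eqP->;
      rewrite ?B ?rcoordD ?thetaD ?rcoordZ ?thetaZ ?(t0, u0, v1, x1, y1, z1, ct, cu, cv, cx, cy, cz)
        ?mulr1 ?mulr0 ?addr0 ?subrr.
  rewrite big_seq; apply: (big_ind (fun r => rcoord 0 r = 0 /\ theta r = 0)).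
  - by split; [apply: (@mpow0 1) | apply/theta_mpow2/mpow0].
  - by move=> a b [a0 a1] [b0 b1]; rewrite rcoordD thetaD a0 b0 a1 b1 !addr0.
  move=> [a w] /Js/J[w0 w1]; rewrite [_ *: _](_ : _ = a * w) // rcoord0M thetaM w0 w1.
  by rewrite !mulr0 addr0.
have [l ->] := of_coords_surj r; rewrite rcoord_of_coords // theta_of_coords => -[l0 l1].
have T s : (t * s) *: one_N = 0 by apply: N_kill; exact: mem_head.
have U s : (u * s) *: one_N = 0 by apply: N_kill; rewrite in_cons; apply/orP; right; exact: mem_head.
have sameN a s : a - x \in [:: t; u; v - x; y - x; z - x] ->
    (a * s) *: one_N = (x * s) *: one_N.
  move=> aJ; have /eqP := N_kill s aJ; rewrite mulrBl scalerBl subr_eq0.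
  by move/eqP.
have V s : (v * s) *: one_N = (x * s) *: one_N.
  by apply: (sameN v s); do 2!(rewrite in_cons; apply/orP; right); exact: mem_head.
have Y s : (y * s) *: one_N = (x * s) *: one_N.
  by apply: (sameN y s); do 3!(rewrite in_cons; apply/orP; right); exact: mem_head.
have Z s : (z * s) *: one_N = (x * s) *: one_N.
  by apply: (sameN z s); do 4!(rewrite in_cons; apply/orP; right); exact: mem_head.
(* The square of x is tx + tv, a multiple of [t], and so vanishes on N. *)
have XX s : (x * (x * s)) *: one_N = 0.
  by rewrite mulrA rel_xx mulrDl scalerDl -!mulrA !T addr0.
rewrite -[of_coords l]mulr1 of_coords_decomp_mul l0 rmorph0 mul0r add0r !scalerDl T U V Y Z add0r add0r.
have -> : kappa l`_3 * 1 + kappa l`_10 * (x * 1) + kappa l`_11 * (y * 1) + kappa l`_12 * (z * 1)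
  = kappa l`_3 + (x * kappa l`_10 + y * kappa l`_11 + z * kappa l`_12) by ring.
rewrite mulrDr scalerDl [X in _ + X + _ + _ + _](_ : _ = 0) ?addr0; last first.
  rewrite !mulrDr !scalerDl XX mulrCA Y XX.
  by rewrite [x * (z * _)]mulrCA Z XX !addr0.
rewrite -!scalerDl -!mulrDr !mulr1 -!rmorphD l1 rmorph0 mulr0.
by rewrite scale0r.
Qed.

Lemma N_eq r s : r *: one_N = s *: one_N <-> rcoord 0 r = rcoord 0 s /\ theta r = theta s.
Proof.
have B : r - s = r + kappa (-1) * s by rewrite rmorphN1 mulN1r.
split=> [/eqP|[e0 e1]].
  rewrite -subr_eq0 -scalerBl => /eqP/N_eq0[].
  rewrite B rcoordD thetaD rcoordZ thetaZ !mulN1r => /eqP + /eqP.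
  by rewrite !subr_eq0 => /eqP -> /eqP ->.
apply/eqP; rewrite -subr_eq0 -scalerBl; apply/eqP/N_eq0.
by rewrite B rcoordD thetaD rcoordZ thetaZ !mulN1r e0 e1 !subrr.
Qed.

Definition theta_mx p q (B : 'M[R]_(p, q)) : 'M[k]_(p, q) := map_mx theta B.

Lemma mx_act_one p q (B : 'M[R]_(q, p)) (n : 'I_p -> N) (r : 'I_p -> R) i :
  (forall j, n j = r j *: one_N) -> mx_act B n i = (\sum_j B i j * r j) *: one_N.
Proof.
move=> nE; rewrite /mx_act scaler_suml; apply: eq_bigr => j _.
by rewrite nE scalerA.
Qed.

Lemma mx_act_scale p q (B : 'M[R]_(q, p)) (r : 'I_p -> R) i :
  mx_act B (fun j => r j *: one_N) i = (\sum_j B i j * r j) *: one_N.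
Proof. exact: mx_act_one. Qed.

Lemma rcoord0_sum (I : finType) (F : I -> R) : rcoord 0 (\sum_i F i) = \sum_i rcoord 0 (F i).
Proof. by apply: (big_morph _ (rcoordD _) _); apply: (@mpow0 1). Qed.

Lemma theta_sum (I : finType) (F : I -> R) : theta (\sum_i F i) = \sum_i theta (F i).
Proof. by apply: (big_morph _ thetaD _); apply/theta_mpow2/mpow0. Qed.

(** A matrix over the maximal ideal sees only the constant terms of a vector over N and lands in
    multiples of x, where it acts as the scalar matrix [theta_mx B]. *)
Lemma minimal_row p q (B : 'M[R]_(q, p)) (r : 'I_p -> R) i : minimal_mx B ->
  rcoord 0 (\sum_j B i j * r j) = 0 /\
  theta (\sum_j B i j * r j) = (theta_mx B *m \col_j rcoord 0 (r j)) i 0.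
Proof.
move=> mB; split.
  by rewrite rcoord0_sum big1 // => j _; rewrite rcoord0M mB mul0r.
rewrite theta_sum mxE; apply: eq_bigr => j _.
by rewrite thetaM mB mul0r add0r !mxE.
Qed.

(** Both the kernel of [B] and the image of [C] are equal to x N^q: the first by injectivity of
    [theta_mx B], the second by surjectivity of [theta_mx C]. *)
Lemma N_mod_exact q (B C : 'M[R]_q) : minimal_mx B -> minimal_mx C ->
  theta_mx B \in unitmx -> theta_mx C \in unitmx -> mod_exact N B C.
Proof.
move=> mB mC uB uC n n0; have [r nE] := choice (fun j => N_gen (n j)).
have r0 : \col_j rcoord 0 (r j) = 0.
  rewrite -[LHS](mulKmx uB) (_ : theta_mx B *m _ = 0) ?mulmx0 //.
  apply/colP => i; have [_ <-] := minimal_row r i mB; rewrite mxE.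
  by have := n0 i; rewrite (mx_act_one _ _ nE) => /N_eq0[].
pose c := invmx (theta_mx C) *m \col_j theta (r j).
exists (fun j => kappa (c j 0) *: one_N) => i.
rewrite nE (mx_act_scale _ (fun j => kappa (c j 0))); apply/N_eq.
have [-> ->] := minimal_row (fun j => kappa (c j 0)) i mC; split.
  by have /colP/(_ i) := r0; rewrite !mxE.
rewrite (_ : \col_j _ = c); first by rewrite /c mulKVmx // mxE.
by apply/colP => j; rewrite mxE rcoord0_kappa.
Qed.

Lemma left_kernel p q (M : 'M[k]_(q, p)) : (p < q)%N ->
  exists w : 'rV_q, exists2 j, w 0 j != 0 & w *m M = 0.
Proof.
move=> lt_pq; have : kermx M != 0.
  rewrite -mxrank_eq0 mxrank_ker subn_eq0 -ltnNge.
  exact: leq_ltn_trans (rank_leq_col M) lt_pq.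
case/rowV0Pn=> w /sub_kermxP wM; case/rV0Pn=> j wj.
by exists w, j.
Qed.

(** As [r < q], a nonzero scalar vector is killed by [theta_mx B] and hence by [B], but the image of
    [C] contains only multiples of x. *)
Lemma N_not_exact_rows p q r (B : 'M[R]_(r, q)) (C : 'M[R]_(q, p)) :
  minimal_mx B -> minimal_mx C -> (r < q)%N -> ~ mod_exact N B C.
Proof.
move=> mB mC lt_rq ex; have [w [j wj wB]] := left_kernel (theta_mx B)^T lt_rq.
have [i|m mE] := ex (fun j => kappa (w 0 j) *: one_N).
  rewrite (mx_act_scale _ (fun j => kappa (w 0 j))); apply/N_eq0.
  have [-> ->] := minimal_row (fun j => kappa (w 0 j)) i mB; split=> //.
  rewrite (_ : \col_j _ = w^T); last by apply/colP => l; rewrite !mxE rcoord0_kappa.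
  by have /rowP/(_ i) := wB; rewrite !mxE => E;
    rewrite -[RHS]E; apply: eq_bigr => l _; rewrite !mxE mulrC.
have [s sE] := choice (fun j => N_gen (m j)).
have := mE j; rewrite (mx_act_one _ _ sE) => /N_eq[+ _].
have [-> _] := minimal_row s j mC.
by rewrite rcoord0_kappa; apply/eqP.
Qed.

(** Every vector in x N^q is a cycle, whereas the image of [C] is x times the column space of
    [theta_mx C], which is proper when [p < q]. *)
Lemma N_not_exact_cols p q r (B : 'M[R]_(r, q)) (C : 'M[R]_(q, p)) :
  minimal_mx B -> minimal_mx C -> (p < q)%N -> ~ mod_exact N B C.
Proof.
move=> mB mC lt_pq ex; have [w [j wj wC]] := left_kernel (theta_mx C) lt_pq.
have [cv cx cy cz] := rcoord0_gens.
have [[_ _ _ x1] _] := gens_theta.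
(* The functional [w] vanishes on that column space but not on the unit vector at [j], so x times
   this unit vector is a cycle outside the image. *)
pose d (i : 'I_q) := kappa (i == j)%:R * x.
have d0 i : rcoord 0 (d i) = 0 by rewrite rcoordZ cx mulr0.
have [i|m mE] := ex (fun i => d i *: one_N).
  rewrite (mx_act_scale _ (d)); apply/N_eq0.
  have [-> ->] := minimal_row d i mB; split=> //.
  by rewrite mxE big1 // => l _; rewrite [X in _ * X]mxE d0 mulr0.
have [s sE] := choice (fun j => N_gen (m j)).
pose c := theta_mx C *m \col_j rcoord 0 (s j).
have cE i : c i 0 = (i == j)%:R.
  have := mE i; rewrite (mx_act_one _ _ sE) => /N_eq[_].
  have [_ ->] := minimal_row s i mC.
  by rewrite thetaZ x1 mulr1.
have : (w *m c) 0 0 = 0 by rewrite /c mulmxA wC mul0mx mxE.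
rewrite mxE (bigD1 j) //= cE eqxx mulr1 big1 ?addr0 => [|i /negPf ij].
  by apply/eqP.
by rewrite cE ij mulr0.
Qed.

(** * The complete resolution of M *)

Section Assembly.

Hypothesis alpha_order : infinite_order alpha.

Let nz_al : alpha != 0. Proof. by case: alpha_order. Qed.
Let al_exp n : alpha ^+ n.+1 != 1. Proof. by case: alpha_order => _; apply. Qed.
Let al1 : alpha != 1. Proof. exact: (al_exp 0). Qed.

Lemma minimal_tr p q (B : 'M[R]_(p, q)) : minimal_mx B -> minimal_mx B^T.
Proof. by move=> mB i j; rewrite mxE. Qed.

Lemma d_entry_minimal c : minimal_mx (nat_mx 2 2 (d_entry c)).
Proof.
have [v0 x0 y0 z0] := rcoord0_gens.
move=> [[|[|//]] hi] [[|[|//]] hj]; rewrite mxE //=.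
by rewrite rcoordZ x0 mulr0.
Qed.

Lemma d_entry_theta_unit c : c != 1 -> theta_mx (nat_mx 2 2 (d_entry c)) \in unitmx.
Proof.
move=> c1; rewrite unitmxE (expand_det_row _ 0) !big_ord_recl big_ord0 /cofactor.
have [[_ _ v1 x1] [y1 z1 _ _]] := gens_theta.
rewrite !det_mx11 !mxE /= v1 y1 thetaZ x1 z1 unitfE.
rewrite (_ : _ + _ = 1 - c) ?subr_eq0 1?eq_sym //.
by rewrite !expr1 !expr0; ring.
Qed.

Variables (b : nat -> nat) (g : nat -> nat -> nat -> R).
Hypothesis b0 : b 0 = 2%N.
Hypothesis b1 : b 1 = 3%N.
Hypothesis g0 : g 0 = e_entry.
Hypothesis b_incr : forall n, (b n < b n.+1)%N.
Hypothesis g_minimal : forall n, minimal_mx (nat_mx (b n) (b n.+1) (g n)).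
Hypothesis g_exact : forall n,
  exact_mx (nat_mx (b n) (b n.+1) (g n)) (nat_mx (b n.+1) (b n.+2) (g n.+1)).

(* The differential from degree i + 1 to degree i is the transpose of
   d_entry (alpha ^+ i.+1) for i >= 0, and of g n for i = - (n + 1). *)
Definition tate_rank (i : int) : nat := match i with Posz _ => 2 | Negz n => b n.+1 end.
Definition tate_entry (i : int) (r s : nat) : R :=
  match i with Posz n => d_entry (alpha ^+ n.+1) s r | Negz n => g n s r end.

Local Notation mt := (mat tate_rank tate_entry).

Lemma tate_rank_opp n : tate_rank (- n%:Z) = b n.
Proof. by case: n. Qed.

Lemma mat_Posz i (n : nat) : i = n.+1%:Z ->
  mt i n%:Z = (nat_mx (tate_rank i) 2 (d_entry (alpha ^+ n.+1)))^T.
Proof.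
by move=> ->; apply/matrixP => r s; rewrite !mxE (_ : _ == _) //; apply/eqP; lia.
Qed.

Lemma mat_Negz i (n : nat) : i = - n%:Z ->
  mt i (Negz n) = (nat_mx (tate_rank i) (b n.+1) (g n))^T.
Proof.
move=> ->; apply/matrixP => r s; rewrite !mxE (_ : _ == _) //; apply/eqP; lia.
Qed.

(** The transposes come first, because they are the D_c and the minimal covers, whose exactness was
    computed directly; the complex itself follows by self-duality. *)
Lemma mat_exact i j l : i = j + 1 -> j = l + 1 ->
  exact_mx (mt i j)^T (mt j l)^T.
Proof.
move=> ij jl; case: l jl => [n|[|n]] jl.
- have jE : j = n.+1%:Z by lia.
  have iE : i = n.+2%:Z by lia.
  clear ij jl; subst i j; rewrite !mat_Posz // !trmxK /=.
  rewrite [alpha ^+ n.+2]exprS; 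
  have an : alpha * alpha ^+ n.+1 != 1 by rewrite -exprS al_exp.
  exact: (exact_d_entry nz_al (al_exp n) an).
(* The splice: here d_0 meets the matrix whose columns generate its kernel. *)
- have jE : j = 0%:Z by lia.
  have iE : i = 1%:Z by lia.
  clear ij jl; subst i j; rewrite mat_Posz // (@mat_Negz _ 0) // !trmxK /=.
  by rewrite expr1 b1 g0; apply: exact_e_entry.
have jE : j = Negz n by lia.
have iE : i = - n%:Z by lia.
clear ij jl; subst j; rewrite mat_Negz // (@mat_Negz _ n.+1) //.
rewrite !trmxK /=; subst i; move: (g_exact n).
by rewrite -[in X in X -> _](tate_rank_opp n).
Qed.

Lemma mat_exact_tr i j l : i = j + 1 -> j = l + 1 -> exact_mx (mt j l) (mt i j).
Proof. by move=> ij jl; have := exact_mx_tr (mat_exact ij jl); rewrite !trmxK. Qed.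

Lemma mat_comp i j l : i = j + 1 -> j = l + 1 -> mt j l *m mt i j = 0.
Proof. by move=> ij jl; case: (mat_exact_tr ij jl). Qed.

Definition tate_complex : complex R := mx_complex mat_comp.

Lemma tate_complex_acyclic : acyclic tate_complex.
Proof.
move=> i; have [l il] : exists l, i = l + 1 by exists (i - 1); rewrite subrK.
apply/(homology_exact _ erefl il); apply: mx_complex_exact_at.
exact: mat_exact_tr.
Qed.

Lemma tate_complex_hom_acyclic : acyclic (hom_complex tate_complex R^o).
Proof.
move=> i; rewrite -[i]opprK; move: (- i) => {}i.
have [l il] : exists l, i = l + 1 by exists (i - 1); rewrite subrK.
apply/(tate_ext_exact _ _ erefl il); apply: mx_complex_dual_acyclic.
exact: mat_exact.
Qed.

(** Truncation by setting the ranks below degree 0 to zero while keeping the entries, so that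
    matrices between nonnegative degrees are the same by computation. *)
Definition tate_rank_ge0 (i : int) : nat := match i with Posz _ => 2 | Negz _ => 0 end.
Local Notation mF := (mat tate_rank_ge0 tate_entry).

Lemma mat_ge0_exact i j l : i = j + 1 -> j = l + 1 -> 0 <= l ->
  exact_mx (mF j l) (mF i j).
Proof.
move=> ij jl; case: l jl => // n jl _; have := mat_exact_tr ij jl.
have jE : j = n.+1%:Z by lia.
have iE : i = n.+2%:Z by lia.
by clear ij jl; subst i j.
Qed.

Lemma mat_ge0_comp i j l : i = j + 1 -> j = l + 1 -> mF j l *m mF i j = 0.
Proof.
move=> ij jl; case: (lerP 0 l) => [l0|]; first by case: (mat_ge0_exact ij jl l0).
by case: l jl => // n jl _; apply: flatmx0.
Qed.

Definition resolution_complex : complex R := mx_complex mat_ge0_comp.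

Lemma d0_mxE : d0_mx alpha = nat_mx 2 2 (d_entry alpha).
Proof.
have E : residue alpha (alpha *: 'X_(@Ordinal 6 3 isT)) = kappa alpha * x by exact: residueZ.
apply/matrixP => i j; case: (split_ordP i) => i' ->; case: (split_ordP j) => j' ->;
  by rewrite (ord1 i') (ord1 j') ?(block_mxEul, block_mxEur, block_mxEdl, block_mxEdr) !mxE /= mulr1n ?E.
Qed.

(** The identification of R^p with its dual. It turns the cokernel defining M, taken on Hom modules,
    into the cokernel of the transposed matrix. *)
Let dual_of (p : nat) (w : 'cV[R]_p) : Defs.hom 'cV[R]_p R^o :=
  projT1 (cid (linear_cV_of (fun i => w i 0 : R^o))).

Lemma dual_ofE p (w : 'cV[R]_p) c : dual_of w c = (w^T *m c) 0 0.
Proof.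
rewrite /dual_of; case: cid => h hE; rewrite /= hE mxE.
by apply: eq_bigr => i _; rewrite mxE; apply: mulrC.
Qed.

Lemma dual_of_surj p (h : Defs.hom 'cV[R]_p R^o) : exists w, h = dual_of w.
Proof.
exists (\col_i h (delta_mx i 0)); apply: homP => c.
rewrite dual_ofE linear_cVE mxE; apply: eq_bigr => i _.
by rewrite !mxE; apply: mulrC.
Qed.

Lemma dual_of_inj p (w w' : 'cV[R]_p) : dual_of w = dual_of w' -> w = w'.
Proof.
move=> e; apply/colP => i; have := congr1 (fun h : Defs.hom _ _ => h (delta_mx i 0)) e.
by rewrite !dual_ofE -!colE !mxE.
Qed.

Lemma dual_of_linear p : linear (@dual_of p).
Proof.
move=> a w w'; apply: homP => c.
rewrite hom_linE !dual_ofE linearP mulmxDl -scalemxAl mxE.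
by congr (_ + _); rewrite mxE.
Qed.

Lemma d0_dual_of w : d0_dual alpha (dual_of w) = dual_of ((d0_mx alpha)^T *m w).
Proof.
apply: homP => c; rewrite dual_ofE trmx_mul trmxK -mulmxA -dual_ofE.
by [].
Qed.

Lemma M_augmentation : exists eps : {linear resolution_complex 0 -> M_mod alpha},
  augmentation eps.
Proof.
have [dl dlE] := linear_of (@dual_of_linear 2).
pose q : {linear Defs.hom 'cV[R]_2 R^o -> M_mod alpha} :=
  qproj (fun h => exists h', h = d0_dual alpha h').
exists (q \o dl); split=> [m|w].
  have [w wE] := dual_of_surj (qrepr m); exists w => /=.
  by rewrite dlE -wE; apply/esym/qreprK.
have mF10 : mF 1 0 = (d0_mx alpha)^T.
  by rewrite d0_mxE; apply/matrixP => r s; rewrite !mxE.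
rewrite /= dlE; split.
  rewrite -(linear0 q) => /qproj_inj; rewrite subr0 => /span_image[h hE].
  have [w' hE'] := dual_of_surj h; exists w'.
  rewrite /= /cpx_diff /= mF10; apply: dual_of_inj.
  by rewrite hE hE' d0_dual_of.
move=> [w' ->]; rewrite /= /cpx_diff /= mF10.
by apply: qproj_eq0; exists (dual_of w'); rewrite d0_dual_of.
Qed.

Lemma resolution_complex_free : free_resolution (M_mod alpha) resolution_complex.
Proof.
split.
- by move=> i; apply: free_cV.
- by case=> // n _ w; apply: flatmx0.
- move=> i i_gt0; have [l il] : exists l, i = l + 1 by exists (i - 1); rewrite subrK.
  apply/(homology_exact _ erefl il); apply: mx_complex_exact_at.
  by apply: mat_ge0_exact => //; lia.
- exact: M_augmentation.
Qed.

Lemma tate_iso_from : iso_from 0 tate_complex resolution_complex.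
Proof.
(* This formula typechecks in every degree; it is the identity matrix for nonnegative i and an empty
   matrix below. *)
exists (fun i : int => mulmx (\matrix_(r < tate_rank_ge0 i, s < tate_rank i) (r == s :> nat)%:R)
  : {linear tate_complex i -> resolution_complex i}).
have phiE (n : nat) (w : 'cV[R]_2) :
    (\matrix_(r < tate_rank_ge0 n, s < tate_rank n) (r == s :> nat)%:R : 'M[R]_2) *m w = w.
  rewrite -[RHS]mul1mx; congr (_ *m w).
  by apply/matrixP => r s; rewrite !mxE.
have ge0E (i : int) : 0 <= i -> exists n : nat, i = n%:Z by case: i => // n; exists n.
split=> i /ge0E[n ->].
  by exists id => w; apply: (phiE n).
move=> w; have [j jE] : exists j, j = n%:Z + 1 by eexists.
have jE' : j = n.+1%:Z by lia.
rewrite -jE in w *; clear jE; subst j.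
apply: etrans (phiE n _) _.
exact: (congr1 (mulmx (mF n.+1 n)) (esym (phiE n.+1 w))).
Qed.

Lemma tate_complex_resolution : complete_resolution (M_mod alpha) tate_complex.
Proof.
split; first by move=> i; apply: finite_free_cV.
- exact: tate_complex_acyclic.
- exact: tate_complex_hom_acyclic.
exists resolution_complex; split; first exact: resolution_complex_free.
by exists 0; apply: tate_iso_from.
Qed.

Lemma tate_pos_units (n : nat) i j l : l = n%:Z -> i = j + 1 -> j = l + 1 ->
  mod_exact (N_mod alpha) (mt j l) (mt i j) /\
  mod_exact (N_mod alpha) (mt i j)^T (mt j l)^T.
Proof.
move=> -> ij jl; have jE : j = n.+1%:Z by lia.
have iE : i = n.+2%:Z by lia.
clear ij jl; subst i j; rewrite !mat_Posz // !trmxK /=.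
have uT c : c != 1 -> theta_mx (nat_mx 2 2 (d_entry c))^T \in unitmx.
  by move=> c1; rewrite /theta_mx -map_trmx unitmx_tr; apply: d_entry_theta_unit.
have mT c : minimal_mx (nat_mx 2 2 (d_entry c))^T by exact: minimal_tr (d_entry_minimal c).
have m c : minimal_mx (nat_mx 2 2 (d_entry c)) by exact: d_entry_minimal.
have [c1 c2] := (al_exp n.+1, al_exp n).
split; first exact: (N_mod_exact (mT _) (mT _) (uT _ c2) (uT _ c1)).
exact: (N_mod_exact (m _) (m _) (d_entry_theta_unit c1) (d_entry_theta_unit c2)).
Qed.

(** Ranks grow as the degree goes down, so the module in degree [i] has smaller rank than that in
    degree [j]. It is the source in the tensor complex and the target in the Hom complex, which
    decides between the two criteria over N. *)
Lemma tate_neg_ranks (n : nat) i j l : l = Negz n.+1 -> i = j + 1 -> j = l + 1 ->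
  ~ mod_exact (N_mod alpha) (mt j l) (mt i j) /\
  ~ mod_exact (N_mod alpha) (mt i j)^T (mt j l)^T.
Proof.
move=> -> ij jl; have jE : j = Negz n by lia.
have iE : i = - n%:Z by lia.
have lt_rk : (tate_rank i < tate_rank j)%N by rewrite iE jE tate_rank_opp; apply: b_incr.
have m1 : minimal_mx (mt i j)^T.
  clear ij jl; subst j; rewrite mat_Negz // trmxK; subst i; rewrite tate_rank_opp.
  exact: g_minimal.
have m2 : minimal_mx (mt j (Negz n.+1))^T.
  by clear ij jl; subst j; rewrite mat_Negz // trmxK; exact: (@g_minimal n.+1).
split.
  by apply: N_not_exact_cols lt_rk; rewrite -[mt _ _]trmxK; apply: minimal_tr.
exact: N_not_exact_rows m1 m2 lt_rk.
Qed.

Lemma tate_ext_pos i : 0 < i -> is_zero (tate_ext tate_complex (N_mod alpha) i).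
Proof.
case: i => [[//|n]|//] _; apply/(@tate_ext_exact _ _ _ (n.+2)%:Z _ n%:Z); try lia.
by apply/hom_exact_mx; apply: (proj2 (tate_pos_units erefl _ _)); lia.
Qed.

Lemma tate_tor_pos i : 0 < i -> is_zero (tate_tor tate_complex (N_mod alpha) i).
Proof.
case: i => [[//|n]|//] _; apply/(@tate_tor_exact _ _ _ (n.+2)%:Z _ n%:Z); try lia.
by apply/tensor_exact_mx; apply: (proj1 (tate_pos_units erefl _ _)); lia.
Qed.

Lemma tate_ext_neg i : i < 0 -> ~ is_zero (tate_ext tate_complex (N_mod alpha) i).
Proof.
case: i => // n _ /(@tate_ext_exact _ _ _ (- n%:Z) _ (Negz n.+1)) ex.
have {}ex : hom_exact tate_complex (N_mod alpha) (- n%:Z) (Negz n) (Negz n.+1) by apply: ex; lia.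
by apply: (proj2 (tate_neg_ranks erefl _ _)) ((hom_exact_mx _ _ _ _ _).1 ex); lia.
Qed.

Lemma tate_tor_neg i : i < 0 -> ~ is_zero (tate_tor tate_complex (N_mod alpha) i).
Proof.
case: i => // n _ /(@tate_tor_exact _ _ _ (- n%:Z) _ (Negz n.+1)) ex.
have {}ex : exact_at (tensor_complex tate_complex (N_mod alpha)) (- n%:Z) (Negz n) (Negz n.+1).
  by apply: ex; lia.
by apply: (proj1 (tate_neg_ranks erefl _ _)) ((tensor_exact_mx _ _ _ _ _).1 ex); lia.
Qed.

End Assembly.

End TheRing.

Theorem theorem3p2 (k : fieldType) (alpha : k)
    (k_not_alg : ~ algebraic_over_finite_field k)
    (alpha_order : infinite_order alpha) :
  (exists T : complex (quadric_ring alpha),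
     complete_resolution (M_mod alpha) T) /\
  forall T : complex (quadric_ring alpha),
    complete_resolution (M_mod alpha) T ->
    [/\ forall i : int, 0 < i -> is_zero (tate_ext T (N_mod alpha) i),
        forall i : int, i < 0 -> ~ is_zero (tate_ext T (N_mod alpha) i),
        forall i : int, 0 < i -> is_zero (tate_tor T (N_mod alpha) i)
      & forall i : int, i < 0 -> ~ is_zero (tate_tor T (N_mod alpha) i)].
Proof.
have [nz_al al_exp] := alpha_order.
have [b [g [b0 g0 b_incr g_min [b1 g_ex]]]] := minimal_resolution nz_al (al_exp 1%N isT).
have resT0 := tate_complex_resolution alpha_order b0 b1 g0 g_ex.
split; first by exists (tate_complex alpha_order b0 b1 g0 g_ex).
move=> T resT; split=> i i0.
- by apply: tate_ext_indep resT resT0 _; apply: tate_ext_pos.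
(* Nonvanishing passes to [T] by contraposition, with the two resolutions in exchanged roles. *)
- by move/(tate_ext_indep resT0 resT); exact: (tate_ext_neg b_incr g_min i0).
- by apply: tate_tor_indep resT resT0 _; apply: tate_tor_pos.
- by move/(tate_tor_indep resT0 resT); exact: (tate_tor_neg b_incr g_min i0).
Qed.
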